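(* Let $T>0$. Let $u$ and $v$ be the mild solutions on $(0,T)$ of $$\partial_t w+\partial_x\left(\tfrac{w^2}{2}\right)+\mathcal{I}[w(t,\cdot)]-\partial_{xx}^2w=0$$ with respective initial data $u_0,v_0\in L^2(\mathbb{R})$, and let $M:=\max\left(\|u\|_{C([0,T];L^2(\mathbb{R}))},\|v\|_{C([0,T];L^2(\mathbb{R}))}\right)$. Then $$\|u-v\|_{C([0,T];L^2(\mathbb{R}))}\le C\left(T,M,\|u_0\|_{L^2(\mathbb{R})},\|v_0\|_{L^2(\mathbb{R})}\right)\,\|u_0-v_0\|_{L^2(\mathbb{R})},$$ where the constant $C$ depends only on $T$, $M$, $\|u_0\|_{L^2(\mathbb{R})}$ and $\|v_0\|_{L^2(\mathbb{R})}$.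
   Context: All functions are real valued. The Fourier transform in the space variable is $\mathcal{F}f(\xi)=\int_{\mathbb{R}}e^{-2i\pi x\xi}f(x)\,dx$, extended to $L^2(\mathbb{R})$. The nonlocal operator $\mathcal{I}$ is defined for Schwartz functions $\varphi$ by $\mathcal{I}[\varphi](x)=\int_0^{+\infty}|\zeta|^{-1/3}\varphi''(x-\zeta)\,d\zeta$; it satisfies $\mathcal{F}(\mathcal{I}[\varphi]-\varphi'')=\psi_{\mathcal{I}}\mathcal{F}\varphi$ with $$\psi_{\mathcal{I}}(\xi)=4\pi^2\xi^2-a|\xi|^{4/3}+i\,b\,\xi|\xi|^{1/3},$$ where $a=\frac49\int_{-\infty}^0\frac{1-\cos(2\pi z)}{|z|^{7/3}}dz>0$ and $b=\frac49\int_{-\infty}^0\frac{\sin(2\pi z)-2\pi z}{|z|^{7/3}}dz>0$. The kernel is $K(t,\cdot)=\mathcal{F}^{-1}(e^{-t\psi_{\mathcal{I}}})$ for $t>0$. A mild solution on $(0,T)$ with initial datum $w_0\in L^2(\mathbb{R})$ is a function $w\in L^\infty((0,T);L^2(\mathbb{R}))$ such that for a.e. $t\in(0,T)$ $$w(t,\cdot)=K(t,\cdot)\ast w_0-\frac12\int_0^t\partial_xK(t-s,\cdot)\ast w^2(s,\cdot)\,ds.$$ For each $w_0\in L^2(\mathbb{R})$ there is exactly one mild solution, and it belongs to $C([0,T];L^2(\mathbb{R}))$ with $w(0,\cdot)=w_0$. *)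

(* Defs.v *)
From HB Require Import structures.
From mathcomp Require Import all_boot all_order all_algebra.
From mathcomp Require Import all_classical all_reals all_analysis.
From mathcomp Require Import measurable_realfun complex ring.
Set Implicit Arguments.
Unset Strict Implicit.
Unset Printing Implicit Defensive.
Import Order.TTheory GRing.Theory Num.Theory.
Import numFieldNormedType.Exports.
Local Open Scope classical_set_scope.
Local Open Scope ring_scope.

Section Defs.
Context {R : realType}.
Local Notation mu := (@lebesgue_measure R).

Lemma continuous_powR_norm (p : R) : 0 < p ->
  continuous (fun x : R => `|x| `^ p).
Proof.
move=> p0 x; have [->|x0] := eqVneq x 0.
  rewrite /continuous_at normr0 powR0 ?gt_eqF//.
  apply/cvgrPdist_lt => e e0; near=> y; rewrite sub0r normrN.
  rewrite ger0_norm ?powR_ge0//.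
  have -> : e = (e `^ p^-1) `^ p by rewrite -powRrM mulVf ?gt_eqF// powRr1// ltW.
  rewrite gt0_ltr_powR// ?nnegrE ?powR_ge0//.
  near: y; have := powR_gt0 p^-1 e0; move: (e `^ _) => r r0.
  have /cvgrPdist_lt/(_ r r0) := @cvg_id _ (nbhs (0:R)).
  by apply: filterS => z; rewrite sub0r normrN.
apply: (@continuous_comp _ _ _ (fun z : R => `|z|) (fun y : R => y `^ p) x).
  exact: norm_continuous.
apply: differentiable_continuous; apply/derivable1_diffP.
by apply: derivable_powR; rewrite in_itv/= andbT normr_gt0.
Unshelve. all: end_near. Qed.

Lemma Rintegral_odd (f : R -> R) : continuous f -> (forall x, f (- x) = - f x) ->
  \int[mu]_x f x = 0.
Proof.
move=> cf fN.
pose g (s x : R) := Num.max (s * f x) 0.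
have cg s : continuous (g s).
  move=> x; apply: (@continuous_max _ _ (fun x => s * f x) (fun=> 0)); last exact: cst_continuous.
  by apply: continuousM; [exact: cst_continuous|exact: cf].
have g0 s x : 0 <= g s x by rewrite /g le_max lexx orbT.
have gN s x : g s (- x) = g (- s) x by rewrite /g fN mulrN mulNr.
have half s : (\int[mu]_(x in [set` `]-oo, 0%R]]) (g s x)%:E =
               \int[mu]_(x in [set` `[0%R, +oo[]) (g (- s) x)%:E)%E.
  rewrite -[X in `]-oo, X]]oppr0 ge0_integration_by_substitutionNy//.
    by apply: eq_integral => x _; rewrite /= gN.
  exact: continuous_subspaceT.
have split s : (\int[mu]_x (g s x)%:E =
    \int[mu]_(x in [set` `[0%R, +oo[]) (g s x)%:E +
    \int[mu]_(x in [set` `[0%R, +oo[]) (g (- s) x)%:E)%E.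
  have mg : measurable_fun setT (g s) by exact: continuous_measurable_fun.
  rewrite -half -(setUv [set x : R | 0 <= x]%R).
  have mpos : measurable [set x : R | 0 <= x]%R by rewrite -set_itvcy.
  rewrite ge0_integral_setU//=; last 4 first.
  - exact: measurableC.
  - by apply/measurable_EFinP; rewrite setUv.
  - by move=> x _; rewrite lee_fin.
  - exact/disj_setPCl.
  rewrite -set_itvcy// setCitvr.
  by rewrite integral_itv_bndo_bndc//; exact/measurable_EFinP/measurable_funTS.
have E : (\int[mu]_x (g 1 x)%:E = \int[mu]_x (g (-1) x)%:E)%E.
  by rewrite !split opprK addeC.
rewrite /Rintegral integralE.
have -> : (\int[mu]_x ((fun x => (f x)%:E)^\+ x) = \int[mu]_x (g 1 x)%:E)%E.
  by apply: eq_integral => x _; rewrite funeposE /g mul1r -EFin_max.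
have -> : (\int[mu]_x ((fun x => (f x)%:E)^\- x) = \int[mu]_x (g 1 x)%:E)%E.
  rewrite E; apply: eq_integral => x _.
  by rewrite funenegE /g mulN1r -EFinN -EFin_max.
have : (0 <= \int[mu]_x (g 1 x)%:E)%E.
  by apply: integral_ge0 => x _; rewrite lee_fin.
by case: (integral _ _ _) => [r| |]//= _; rewrite subrr.
Qed.

Definition cexp (z : R[i]) : R[i] :=
  ((expR (complex.Re z) * cos (complex.Im z))
   +i* (expR (complex.Re z) * sin (complex.Im z)))%C.

Definition cintegral (g : R -> R[i]) : R[i] :=
  ((\int[mu]_x complex.Re (g x)) +i* (\int[mu]_x complex.Im (g x)))%C.

(* The integral formula, with kernel e^{2 i pi x xi}. It is only used on
   symbols in L^1 /\ L^2, where it is the L^2 inverse Fourier transform. *)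
Definition inverse_fourier (g : R -> R[i]) (x : R) : R[i] :=
  cintegral (fun xi => cexp (0 +i* (2 * pi * x * xi))%C * g xi).

Definition coef_a : R :=
  4 / 9 * \int[mu]_(z in `]-oo, 0[)
            ((1 - cos (2 * pi * z)) / `|z| `^ (7 / 3)).

Definition coef_b : R :=
  4 / 9 * \int[mu]_(z in `]-oo, 0[)
            ((sin (2 * pi * z) - 2 * pi * z) / `|z| `^ (7 / 3)).

(* F (I[phi] - phi'') = psi_I * F phi, where
   I[phi](x) = \int_0^oo |zeta|^(-1/3) phi''(x - zeta) dzeta. *)
Definition psi_I (xi : R) : R[i] :=
  ((4 * pi ^+ 2 * xi ^+ 2 - coef_a * `|xi| `^ (4 / 3))
   +i* (coef_b * (xi * `|xi| `^ (1 / 3))))%C.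

Definition kernel_symbol (t xi : R) : R[i] := cexp (- (t%:C%C * psi_I xi)).

Definition kernelC (t : R) : R -> R[i] := inverse_fourier (kernel_symbol t).

Lemma Im_kernelC (t x : R) : complex.Im (kernelC t x) = 0.
Proof.
pose f (y : R) := expR (- (t * complex.Re (psi_I y)))
   * sin (2 * pi * x * y - t * complex.Im (psi_I y)).
rewrite /kernelC /inverse_fourier /cintegral /=.
transitivity (\int[mu]_x f x).
  apply: eq_Rintegral => y _; rewrite /f /kernel_symbol /cexp /=.
  rewrite !mul0r ?subr0 ?addr0 expR0 !mul1r.
  rewrite ?cosN ?sinN sinB. ring.
apply: Rintegral_odd => [|y].
  have c43 : continuous (fun y : R => `|y| `^ (4 / 3)).
    exact: continuous_powR_norm.
  have c13 : continuous (fun y : R => `|y| `^ (1 / 3)).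
    exact: continuous_powR_norm.
  have cc (r : R) : continuous (fun _ : R => r) by move=> y; exact: cvg_cst.
  have cM (g h : R -> R) : continuous g -> continuous h ->
      continuous (fun y => g y * h y).
    by move=> cg ch y; exact: (continuousM (cg y) (ch y)).
  have cB (g h : R -> R) : continuous g -> continuous h ->
      continuous (fun y => g y - h y).
    by move=> cg ch y; exact: (continuousB (cg y) (ch y)).
  have cid : continuous (fun y : R => y) by move=> y; exact: cvg_id.
  have cre : continuous (fun y : R => complex.Re (psi_I y)).
    have cX : continuous (fun y : R => y ^+ 2) by exact: exprn_continuous.
    exact: (cB _ _ (cM _ _ (cc (4 * pi ^+ 2)) cX) (cM _ _ (cc coef_a) c43)).
  have cim : continuous (fun y : R => complex.Im (psi_I y)).
    exact: (cM _ _ (cc coef_b) (cM _ _ cid c13)).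
  have c1 : continuous (fun y : R => expR (- (t * complex.Re (psi_I y)))).
    move=> y; apply: (@continuous_comp _ _ _
      (fun y : R => - (t * complex.Re (psi_I y))) expR y).
      exact: (continuousN (cM _ _ (cc t) cre y)).
    exact: continuous_expR.
  have c2 : continuous
      (fun y : R => sin (2 * pi * x * y - t * complex.Im (psi_I y))).
    move=> y; apply: (@continuous_comp _ _ _
      (fun y : R => 2 * pi * x * y - t * complex.Im (psi_I y)) sin y);
      last exact: continuous_sin.
    exact: (cB _ _ (cM _ _ (cc _) cid) (cM _ _ (cc t) cim) y).
  exact: cM c1 c2.
rewrite /f /= normrN sqrrN !mulrN !mulNr !mulrN -opprD sinN mulrN.
by rewrite ?opprK.
Qed.

(* Taking the real part loses nothing, by [Im_kernelC]. *)
Definition kernel (t x : R) : R := complex.Re (kernelC t x).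

Definition convolution (f g : R -> R) (x : R) : R :=
  \int[mu]_y (f (x - y) * g y).

Definition L2 : {pred R -> R} := Lfun mu 2%:E.

Definition L2norm (f : R -> R) : \bar R := 'N[mu]_2%:E[EFin \o f].

(* L^oo((0, T); L^2): a function of time with values in L^2 is represented by
   a function w of (t, x) that is jointly Borel on ]0, T[ x R; every strongly
   measurable L^2-valued function has such a representative. *)
Definition Linfty_L2 (T : R) (w : R -> R -> R) : Prop :=
  measurable_fun (`]0, T[ `*` [set: R]) (fun p : R * R => w p.1 p.2) /\
  exists B : R,
    {ae mu, forall t : R, t \in `]0, T[ -> (L2norm (w t) <= B%:E)%E}.

(* The equality in L^2 is an equality for a.e. x, and the L^2-valued time
   integral is computed pointwise in x: its integrand is absolutely integrable
   on ]0, t[ for a.e. x, because the L^2 norm of d/dx K(t - s) is integrable in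
   s and w^2 is in L^oo((0, T); L^1). *)
Definition mild_solution (T : R) (w0 : R -> R) (w : R -> R -> R) : Prop :=
  Linfty_L2 T w /\
  {ae mu, forall t : R, t \in `]0, T[ ->
    {ae mu, forall x,
      w t x = convolution (kernel t) w0 x
        - 1 / 2 * \int[mu]_(s in `]0, t[)
            convolution (derive1 (kernel (t - s))) (fun y => w s y ^+ 2) x}}.

(* C([0, T]; L^2). A class in L^oo((0, T); L^2) that contains a continuous
   function contains only one, so for a mild solution this predicate only
   selects the representative (including its values at the endpoints). *)
Definition C_L2 (T : R) (w : R -> R -> R) : Prop :=
  (forall t : R, t \in `[0, T] -> w t \in L2) /\
  (forall t : R, t \in `[0, T] ->
     L2norm (w s \- w t) @[s --> within `[0, T] (nbhs t)] --> 0%E).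

Definition C_L2norm (T : R) (w : R -> R -> R) : \bar R :=
  ereal_sup [set L2norm (w t) | t in `[0, T]].

End Defs.
Arguments L2 : clear implicits.

(* Main.v *)
Require Import Defs.
From HB Require Import structures.
From mathcomp Require Import all_boot all_order all_algebra.
From mathcomp Require Import all_classical all_reals all_analysis.
From mathcomp Require Import measurable_realfun complex ring lra zify.
Import Order.TTheory GRing.Theory Num.Theory.
Import numFieldNormedType.Exports.
Set Implicit Arguments.
Unset Strict Implicit.
Unset Printing Implicit Defensive.
Local Open Scope classical_set_scope.
Local Open Scope ring_scope.

(** Write D(t) for the L^2 norm of u(t) - v(t) and D0 for that of u0 - v0.
    Subtracting the two mild formulations and using
    u^2 - v^2 = (u - v) (u + v), whose L^1 norm at time s is at most 2 M D(s),
    Young's inequality gives, for almost every t,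
      D(t) <= |K(t)|_1 D0 + M \int_0^t |dK/dx (t - s)|_2 D(s) ds.
    The theorem is then a Gronwall argument with an integrable singularity,
    as soon as, for t in ]0, T],
      |K(t)|_1 is bounded   and   |dK/dx (t)|_2 = O(t^(-3/4)).

    Both facts about the kernel come from pointwise bounds.  By parity,
      K(t, x) = 2 \int_0^oo e^(-t p) cos(2 pi x xi - t q) dxi,
    where p and q are the real and imaginary parts of the symbol.  For t <= T
    the Gaussian part of p dominates, so e^(-t p) behaves like a function of
    sqrt(t) xi decaying faster than any power.  Bounding the integrand by its
    modulus controls K and dK/dx by t^(-1/2) and t^(-1); integrating by parts,
    twice for K and once for dK/dx, controls x^2 K and x dK/dx by t^(1/2) and
    t^(-1/2).  The symbol is only C^1 at the origin, but its second derivative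
    is of order xi^(-2/3) there, which is integrable.  Each integration by
    parts is a single application of the fundamental theorem of calculus
    ([osc_bounds]); the resulting bounds ([kernel_bounds]) have explicitly
    integrable majorants.

    The Duhamel term is estimated by one Cauchy-Schwarz inequality on the
    (s, y)-plane with weight (t - s)^(-3/4) |N(s, y)|, followed by Tonelli's
    theorem ([duhamel_L2]); this plays the part of Minkowski's integral
    inequality and also shows that the time integrals in the mild formulation
    converge absolutely for almost every x.

    For the Gronwall step ([stability]), suppose D(s) <= Th e^(lambda s) on
    [0, T].  The inequality above then improves this to
    D(t) <= (2 C D0 + Th / 2) e^(lambda t) when lambda is large compared with
    a power of M, for almost every t and hence, by continuity, for every t.
    The best possible Th is finite because D is bounded, and it satisfies
    Th <= 2 C D0 + Th / 2, that is, Th <= 4 C D0. *)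

(** * Integrals of exact derivatives on the half-line *)

Section HalfLine.
Context {R : realType}.
Local Notation mu := (@lebesgue_measure R).
Implicit Types (f h F H : R -> R).

Lemma FTC2_pos f F (a b : R) : 0 < a -> a < b ->
  (forall x : R, 0 < x -> {for x, continuous f}) ->
  (forall x : R, 0 < x -> is_derive x 1 F (f x)) ->
  (\int[mu]_(x in `[a, b]) (f x)%:E = (F b - F a)%:E)%E.
Proof.
move=> a0 ab cf dF; have b0 : 0 < b by exact: lt_trans ab.
have cF x : 0 < x -> {for x, continuous F}.
  by move=> x0; have dFx := dF x x0; apply/differentiable_continuous/derivable1_diffP.
rewrite EFinB; apply: continuous_FTC2 => //.
- apply: continuous_in_subspaceT => x; rewrite inE/= in_itv/= => /andP[ax _].
  by apply: cf; exact: lt_le_trans ax.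
- split=> [x||].
  + rewrite in_itv/= => /andP[ax _]; have dFx := dF x (lt_trans a0 ax).
    exact: ex_derive.
  + by apply: cvg_at_right_filter; exact: cF.
  + by apply: cvg_at_left_filter; exact: cF.
- move=> x; rewrite in_itv/= => /andP[ax _]; have dFx := dF x (lt_trans a0 ax).
  by rewrite derive1E derive_val.
Qed.

(** Compact intervals exhausting ]0, +oo[; they stay away from both ends, where
    the integrands below may be singular or the primitives undefined. *)
Definition exhaust (n : nat) : set R := `[(n.+2%:R)^-1, n.+2%:R].

Lemma exhaust_gt0 n x : exhaust n x -> 0 < x.
Proof.
rewrite /exhaust/= in_itv/= => /andP[nx _].
by apply: lt_le_trans nx; rewrite invr_gt0.
Qed.

Lemma exhaust_nd : nondecreasing_seq exhaust.
Proof.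
move=> n m nm; apply/subsetPset => x; rewrite /exhaust/= !in_itv/=.
have nm' : n.+2%:R <= m.+2%:R :> R by rewrite ler_nat !ltnS.
move=> /andP[nx xn]; apply/andP; split; last exact: le_trans nm'.
by apply: le_trans nx; rewrite lef_pV2 ?posrE.
Qed.

Lemma exhaustP x : 0 < x -> \forall n \near \oo, exhaust n x.
Proof.
move=> x0; near=> n; rewrite /exhaust/= in_itv/=; apply/andP; split.
- rewrite invf_ple ?posrE//.
  rewrite (@le_trans _ _ n%:R)//; last by rewrite ler_nat; lia.
  by near: n; exact: nbhs_infty_ger.
- rewrite (@le_trans _ _ n%:R)//; last by rewrite ler_nat; lia.
  by near: n; exact: nbhs_infty_ger.
Unshelve. all: end_near. Qed.

Lemma bigcup_exhaust : \bigcup_n exhaust n = `]0, +oo[%classic.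
Proof.
apply/seteqP; split => [x [n _ /exhaust_gt0 x0]|x/=].
  by rewrite /= in_itv/= x0.
rewrite in_itv/= andbT => /exhaustP[n _ nx].
by exists n => //; apply: nx => /=.
Qed.

Lemma continuous_pos_measurable f : (forall x : R, 0 < x -> {for x, continuous f}) ->
  measurable_fun (`]0, +oo[%classic : set R) f.
Proof.
move=> cf; apply: open_continuous_measurable_fun => // x.
by rewrite inE/= in_itv/= andbT => /cf.
Qed.

(** On a compact interval the integral is an increment of the primitive, hence
    at most [C]; monotone convergence gives the half-line. *)
Lemma ge0_integral_bounded_primitive h H (C : R) :
  (forall x : R, 0 < x -> 0 <= h x) ->
  (forall x : R, 0 < x -> {for x, continuous h}) ->
  (forall x : R, 0 < x -> is_derive x 1 H (h x)) ->
  (forall x : R, 0 < x -> 0 <= H x <= C) ->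
  (\int[mu]_(x in `]0%R, +oo[) (h x)%:E <= C%:E)%E.
Proof.
move=> h0 ch dH HC.
have mh : measurable_fun (`]0, +oo[%classic : set R) h by exact: continuous_pos_measurable.
rewrite -bigcup_exhaust.
have cvg : (\int[mu]_(x in exhaust i) (h x)%:E)%E @[i --> \oo] -->
   (\int[mu]_(x in \bigcup_i exhaust i) (h x)%:E)%E.
  apply: ge0_nondecreasing_set_cvg_integral => [|i|i|i x].
  - exact: exhaust_nd.
  - exact: measurable_itv.
  - apply/measurable_EFinP; apply: measurable_funS mh => //.
    by rewrite -bigcup_exhaust; exact: bigcup_sup.
  - by move=> /exhaust_gt0 /h0; rewrite lee_fin.
rewrite -(cvg_lim _ cvg)//; apply: lime_le.
  by apply/cvg_ex; eexists; exact: cvg.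
apply: nearW => n; rewrite /exhaust (@FTC2_pos h H)//.
- rewrite lee_fin.
  have /HC/andP[_ ?] : 0 < n.+2%:R :> R by [].
  have /HC/andP[? _] : 0 < n.+2%:R^-1 :> R by rewrite invr_gt0.
  lra.
- by rewrite (@lt_trans _ _ 1)// ?ltr1n// invf_lt1 ?ltr1n.
Qed.

(** Integration by parts on the half-line takes this form: an exact derivative
    has integral zero when its primitive vanishes at both ends.  Integrability
    justifies the passage to the limit along compact intervals. *)
Lemma Rintegral_derive_vanishing f F :
  (forall x : R, 0 < x -> {for x, continuous f}) ->
  (forall x : R, 0 < x -> is_derive x 1 F (f x)) ->
  mu.-integrable `]0, +oo[ (EFin \o f) ->
  F x @[x --> 0^'+] --> 0 -> F x @[x --> +oo] --> 0 ->
  \int[mu]_(x in `]0, +oo[) f x = 0.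
Proof.
move=> cf dF fi F0 Fy.
have mf : measurable_fun (`]0, +oo[%classic : set R) f by exact: continuous_pos_measurable.
have exS n : exhaust n `<=` `]0, +oo[%classic.
  by move=> x /exhaust_gt0; rewrite /= in_itv/= andbT.
have [|||||_ _] := @dominated_convergence _ _ R mu `]0%R, +oo[ (measurable_itv _)
  (fun n => (EFin \o f) \_ (exhaust n)) (EFin \o f) (abse \o (EFin \o f)).
- move=> n; apply/measurable_restrict => //; first exact: measurable_itv.
  by apply: measurable_funS (measurable_int _ fi) => // x [].
- exact/measurable_EFinP.
- apply: aeW => x /=; rewrite in_itv/= andbT => x0.
  apply: cvg_near_cst; near=> n; rewrite patchE mem_set//.
  by near: n; exact: exhaustP.
- exact: integrable_abse.
- by apply: aeW => x n _; rewrite patchE; case: ifP => //= _; rewrite ?normr0 lee_fin.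
set u := (X in X @ _ --> _) => cvgu.
have uE n : u n = (F n.+2%:R - F n.+2%:R^-1)%:E.
  rewrite /u/= -integral_mkcondr setIidr//.
  apply: FTC2_pos => //.
  by rewrite (@lt_trans _ _ 1)// ?ltr1n// invf_lt1 ?ltr1n.
suff u0 : u @ \oo --> 0%:E.
  by rewrite /Rintegral (cvg_unique _ cvgu u0).
rewrite (_ : u = EFin \o (fun n => F n.+2%:R - F n.+2%:R^-1)); last exact/funext.
apply: cvg_EFin; first exact: nearW.
rewrite -[X in _ --> X]subr0; apply: cvgB.
- by apply: (cvg_comp _ _ _ Fy); apply/cvgryPge => A; near=> n;
    rewrite (@le_trans _ _ n%:R)//; [near: n; exact: nbhs_infty_ger|
    rewrite ler_nat; lia].
- move/cvg_at_rightP : F0; apply; split; first by move=> n; rewrite invr_gt0.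
  apply/cvgrPdist_lt => e e0; near=> n; rewrite sub0r normrN gtr0_norm ?invr_gt0//.
  rewrite invf_plt ?posrE// (@lt_le_trans _ _ n%:R)//; last by rewrite ler_nat; lia.
  by near: n; exact: nbhs_infty_gtr.
Unshelve. all: end_near. Qed.

End HalfLine.

Section Profile.
Context {R : realType}.
Local Notation mu := (@lebesgue_measure R).

Lemma continuous_powR (a x : R) : 0 < x -> {for x, continuous (fun z : R => z `^ a)}.
Proof.
move=> x0; have dx := is_derive1_powR a x0.
by apply/differentiable_continuous/derivable1_diffP; exact: ex_derive.
Qed.

(** The derivative of the increasing function w x^a / (1 + w x^a), which goes
    from 0 to 1.  With a < 1 it is singular like x^(a-1) at 0, and still
    integrable; as its integral does not depend on [w], it carries all the
    scaling in time and frequency. *)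
Definition profile (a w x : R) : R := a * w * x `^ (a - 1) / (1 + w * x `^ a) ^+ 2.

Lemma profile_ge0 (a w x : R) : 0 <= a -> 0 <= w -> 0 <= profile a w x.
Proof.
move=> a0 w0; rewrite /profile divr_ge0//; last exact: sqr_ge0.
by rewrite !mulr_ge0// powR_ge0.
Qed.

Lemma continuous_profile (a w x : R) : 0 < a -> 0 < w -> 0 < x ->
  {for x, continuous (profile a w)}.
Proof.
move=> a0 w0 x0.
have den : 0 < 1 + w * x `^ a by rewrite ltr_pwDl// mulr_ge0 ?powR_ge0// ltW.
have ca b : {for x, continuous (fun z : R => z `^ b)} by exact: continuous_powR.
have cc (b : R) : {for x, continuous (fun=> b)} by exact: cvg_cst.
have cd := continuousD (cc 1) (continuousM (cc w) (ca a)).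
have cn := continuousM (cc (a * w)) (ca (a - 1)).
have nz : (1 + w * x `^ a) ^+ 2 != 0 by rewrite gt_eqF// exprn_gt0.
have cv := @continuousV _ _ (fun z : R => (1 + w * z `^ a) ^+ 2) x nz (continuousM cd cd).
exact: (continuousM cn cv).
Qed.

Lemma profile_integral (a w : R) : 0 < a -> 0 < w ->
  (\int[mu]_(x in `]0%R, +oo[) (profile a w x)%:E <= 1%:E)%E.
Proof.
move=> a0 w0.
have den x : 0 < 1 + w * x `^ a by rewrite ltr_pwDl// mulr_ge0 ?powR_ge0// ltW.
apply: (@ge0_integral_bounded_primitive _ _
  (fun x => 1 - (1 + w * x `^ a)^-1)) => x x0.
- by rewrite profile_ge0// ltW.
- exact: continuous_profile.
- have dx := is_derive1_powR a x0.
  have dn := den x; have dn0 : 1 + w * x `^ a != 0 by rewrite gt_eqF.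
  have d1 : is_derive x 1 (fun z : R => 1 + w * z `^ a) (w * (a * x `^ (a - 1))).
    by apply: is_derive_eq; rewrite add0r mul1r.
  have d2 := @is_deriveV _ (fun z : R => 1 + w * z `^ a) x _ _ dn0 d1.
  apply: is_derive_eq; rewrite /profile /GRing.scale/=; field; exact: dn0.
- have i0 : 0 < (1 + w * x `^ a)^-1 by rewrite invr_gt0.
  have i1 : (1 + w * x `^ a)^-1 <= 1.
    by rewrite invf_le1// lerDl mulr_ge0 ?powR_ge0 ?ltW.
  by apply/andP; split; lra.
Qed.

(** The identity is proved separately for the positive and negative parts, and
    the conventions of the real-valued integral preserve it when one of their
    integrals is infinite. *)
Lemma Rintegral_even (f : R -> R) : continuous f -> f =1 f \o -%R ->
  \int[mu]_x f x = 2 * \int[mu]_(x in `]0, +oo[) f x.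
Proof.
move=> cf ef.
have half (g : R -> R) : (forall x, 0 <= g x) -> continuous g -> g =1 g \o -%R ->
    (\int[mu]_x (g x)%:E = 2%:E * \int[mu]_(x in `]0%R, +oo[) (g x)%:E)%E.
  move=> g0 cg eg; rewrite ge0_symfun_integralT// -set_itvcy.
  rewrite integral_itv_obnd_cbnd//; apply/measurable_EFinP/measurable_funTS.
  exact: continuous_measurable_fun.
pose g (s x : R) := Num.max (s * f x) 0.
have cg s : continuous (g s).
  move=> x; apply: (@continuous_max _ _ (fun x => s * f x) (fun=> 0)); last exact: cst_continuous.
  by apply: continuousM; [exact: cst_continuous|exact: cf].
have g0 s x : 0 <= g s x by rewrite /g le_max lexx orbT.
have eg s : g s =1 g s \o -%R by move=> x; rewrite /g/= {1}ef.
have gE D : (\int[mu]_(x in D) f x =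
    fine (\int[mu]_(x in D) (g 1 x)%:E - \int[mu]_(x in D) (g (-1) x)%:E))%R.
  rewrite /Rintegral integralE; congr (fine (_ - _))%E; apply: eq_integral => x _.
    by rewrite funeposE /g mul1r -EFin_max.
  by rewrite funenegE /g mulN1r -EFinN -EFin_max.
rewrite !gE !half//.
have : (0 <= \int[mu]_(x in `]0%R, +oo[) (g 1 x)%:E)%E.
  by apply: integral_ge0 => x _; rewrite lee_fin.
have : (0 <= \int[mu]_(x in `]0%R, +oo[) (g (-1) x)%:E)%E.
  by apply: integral_ge0 => x _; rewrite lee_fin.
case: (integral _ _ _) => [a| |]//; case: (integral _ _ _) => [b| |]// _ _ /=.
- by rewrite mulrBr.
- by rewrite mulry gtr0_sg// mul1e/= mulr0.
- by rewrite mulry gtr0_sg// mul1e/= mulr0.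
- by rewrite mulry gtr0_sg// mul1e/= mulr0.
Qed.

End Profile.

(** * Cube roots and continuity *)

Section CubeRoot.
Context {R : realType}.
Implicit Types x y : R.

(** On the half-line the symbol is a polynomial in the cube root of the
    frequency. *)
Definition cbrt x : R := x `^ 3^-1.

Lemma cbrt_gt0 x : 0 < x -> 0 < cbrt x.
Proof. exact: powR_gt0. Qed.

Lemma cbrtK x : 0 <= x -> cbrt x ^+ 3 = x.
Proof.
by move=> x0; rewrite /cbrt -powR_mulrn ?powR_ge0// -powRrM mulVf// powRr1.
Qed.

Lemma powR_thirdB1 x : 0 < x -> x `^ (3^-1 - 1) = (cbrt x ^+ 2)^-1.
Proof.
move=> x0; have s0 := cbrt_gt0 x0.
rewrite powRB; last by rewrite (gt_eqF x0) implybT.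
rewrite powRr1 ?ltW// -/(cbrt x).
move: (cbrt x) s0 (cbrtK (ltW x0)) => s s0 <-.
by field; rewrite gt_eqF.
Qed.

Lemma is_derive_cbrt x : 0 < x -> is_derive x 1 cbrt ((cbrt x ^+ 2)^-1 / 3).
Proof.
move=> x0; have d := is_derive1_powR 3^-1 x0.
by apply: is_derive_eq; rewrite powR_thirdB1// mulrC.
Qed.

Lemma continuous_cbrt x : 0 < x -> {for x, continuous cbrt}.
Proof. exact: continuous_powR. Qed.

Lemma cbrt_cvg0 : cbrt x @[x --> 0^'+] --> (0 : R).
Proof. by apply: powR_cvg0; rewrite invr_gt0. Qed.

End CubeRoot.

Section ContinuityCalculus.
Context {R : realType}.
Variables (T : topologicalType) (x : T).
Implicit Types f g : T -> R.

Lemma fcontinuousM f g : continuous_at x f -> continuous_at x g ->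
  continuous_at x (fun z => f z * g z).
Proof. exact: continuousM. Qed.

Lemma fcontinuousD f g : continuous_at x f -> continuous_at x g ->
  continuous_at x (fun z => f z + g z).
Proof. exact: continuousD. Qed.

Lemma fcontinuousN f : continuous_at x f -> continuous_at x (fun z => - f z).
Proof. exact: continuousN. Qed.

Lemma fcontinuousX n f : continuous_at x f -> continuous_at x (fun z => f z ^+ n).
Proof.
move=> cf; apply: (@continuous_comp _ _ _ f (fun z : R => z ^+ n) x cf).
exact: exprn_continuous.
Qed.

Lemma fcontinuous_expR f : continuous_at x f -> continuous_at x (fun z => expR (f z)).
Proof.
by move=> cf; apply: (@continuous_comp _ _ _ f expR x cf); exact: continuous_expR.
Qed.

Lemma fcontinuous_cos f : continuous_at x f -> continuous_at x (fun z => cos (f z)).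
Proof.
by move=> cf; apply: (@continuous_comp _ _ _ f cos x cf); exact: continuous_cos.
Qed.

Lemma fcontinuous_sin f : continuous_at x f -> continuous_at x (fun z => sin (f z)).
Proof.
by move=> cf; apply: (@continuous_comp _ _ _ f sin x cf); exact: continuous_sin.
Qed.

Lemma fcontinuousV f : continuous_at x f -> f x != 0 ->
  continuous_at x (fun z => (f z)^-1).
Proof. by move=> cf fx; exact: (@continuousV _ _ f x fx cf). Qed.

Lemma fcontinuous_cst (c : R) : continuous_at x (fun _ : T => c).
Proof. exact: cvg_cst. Qed.

End ContinuityCalculus.

(** Structural continuity proofs.  The goal is matched syntactically: letting
    unification look for the head operation would unfold the definitions. *)
Ltac fcont := lazymatch goal with
  | |- continuous_at _ (fun=> ?c) => exact: fcontinuous_cst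
  | |- continuous_at _ (fun z => z) => exact: cvg_id
  | |- continuous_at _ (fun z => @?f z + @?g z) =>
      apply: (@fcontinuousD _ _ _ f g); fcont
  | |- continuous_at _ (fun z => @?f z * @?g z) =>
      apply: (@fcontinuousM _ _ _ f g); fcont
  | |- continuous_at _ (fun z => - @?f z) => apply: (@fcontinuousN _ _ _ f); fcont
  | |- continuous_at _ (fun z => @?f z ^+ ?n) => apply: (@fcontinuousX _ _ _ n f); fcont
  | |- continuous_at _ (fun z => (@?f z)^-1) => apply: (@fcontinuousV _ _ _ f); [fcont|]
  | |- continuous_at _ (fun z => expR (@?f z)) => apply: (@fcontinuous_expR _ _ _ f); fcont
  | |- continuous_at _ (fun z => cos (@?f z)) => apply: (@fcontinuous_cos _ _ _ f); fcont
  | |- continuous_at _ (fun z => sin (@?f z)) => apply: (@fcontinuous_sin _ _ _ f); fcont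
  | |- _ => try assumption
  end.

(** * Damped oscillations and integration by parts *)

Section PhaseCalculus.
Context {R : realType}.
Implicit Types P Q : R -> R.

(** With [P = t Re psi] and [Q = t Im psi], [wave_cos] and [wave_sin] are the
    real and imaginary parts of exp (i y z - t psi(z)). *)
Definition wave_cos P Q (y z : R) : R := expR (- P z) * cos (y * z - Q z).
Definition wave_sin P Q (y z : R) : R := expR (- P z) * sin (y * z - Q z).

Lemma normr_wave_cos P Q (y z : R) : `|wave_cos P Q y z| <= expR (- P z).
Proof.
by rewrite /wave_cos normrM gtr0_norm ?expR_gt0// ler_piMr ?expR_ge0 ?cos_max.
Qed.

Lemma normr_wave_sin P Q (y z : R) : `|wave_sin P Q y z| <= expR (- P z).
Proof.
by rewrite /wave_sin normrM gtr0_norm ?expR_gt0// ler_piMr ?expR_ge0 ?sin_max.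
Qed.

Variables (P P1 Q Q1 : R -> R) (P2 Q2 x y : R).
Hypotheses (dP : is_derive x 1 P (P1 x)) (dP1 : is_derive x 1 P1 P2).
Hypotheses (dQ : is_derive x 1 Q (Q1 x)) (dQ1 : is_derive x 1 Q1 Q2).
Local Notation C := (wave_cos P Q y).
Local Notation S := (wave_sin P Q y).

Lemma is_derive_wave_cos :
  is_derive x 1 C (- P1 x * C x - (y - Q1 x) * S x).
Proof. by apply: is_derive_eq; rewrite /wave_cos /wave_sin /GRing.scale/=; ring. Qed.

Lemma is_derive_wave_sin :
  is_derive x 1 S (- P1 x * S x + (y - Q1 x) * C x).
Proof. by apply: is_derive_eq; rewrite /wave_cos /wave_sin /GRing.scale/=; ring. Qed.

(** The real part of (i y E + t psi' E)' = t psi'' E - (t psi')^2 E - y^2 E for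
    E = exp (i y z - t psi(z)): two integrations by parts at once, which trade
    a factor y^2 for derivatives of the symbol. *)
Lemma is_derive_two_parts :
  is_derive x 1 (fun z => P1 z * C z - (y + Q1 z) * S z)
    ((P2 - P1 x ^+ 2 + Q1 x ^+ 2) * C x + (2 * P1 x * Q1 x - Q2) * S x
     - y ^+ 2 * C x).
Proof.
have dC := is_derive_wave_cos; have dS := is_derive_wave_sin.
by apply: is_derive_eq; rewrite /GRing.scale/=; ring.
Qed.

(** The real part of (z E)' = (1 - t z psi') E + i y z E. *)
Lemma is_derive_one_part :
  is_derive x 1 (fun z => z * C z)
    ((1 - x * P1 x) * C x + x * Q1 x * S x - y * (x * S x)).
Proof.
have dC := is_derive_wave_cos.
by apply: is_derive_eq; rewrite /GRing.scale/=; ring.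
Qed.

End PhaseCalculus.

(** * The damping factor *)

Section Damping.
Context {R : realType}.
Local Notation mu := (@lebesgue_measure R).

(** Here [r ^+ 6] stands for t xi^2, so this is Gaussian decay measured in the
    cube root of the rescaled frequency.  It follows from
    (1 + r)^6 <= 64 (1 + r^6) and exp x >= (1 + x / 2)^2. *)
Lemma expR_sextic (r : R) : 0 <= r -> (1 + r) ^+ 10 * expR (- r ^+ 6) <= 2 ^+ 14.
Proof.
move=> r0; have r6 : 0 <= r ^+ 6 by exact: exprn_ge0.
(* compare 1 + r with 2 max(1, r) *)
have h6 : (1 + r) ^+ 6 <= 64 * (1 + r ^+ 6).
  have [r1|r1] := leP r 1.
    have : (1 + r) ^+ 6 <= 2 ^+ 6 by apply: lerXn2r; rewrite ?nnegrE; lra.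
    by lra.
  have : (1 + r) ^+ 6 <= (2 * r) ^+ 6 by apply: lerXn2r; rewrite ?nnegrE; lra.
  by rewrite exprMn; lra.
have h10 : (1 + r) ^+ 10 <= (1 + r) ^+ 12 by apply: ler_weXn2l => //; lra.
have h12 : (1 + r) ^+ 12 <= (64 * (1 + r ^+ 6)) ^+ 2.
  by rewrite (exprM _ 6 2); apply: lerXn2r => //; rewrite nnegrE ?exprn_ge0//; lra.
have he : (1 + r ^+ 6 / 2) ^+ 2 <= expR (r ^+ 6).
  have -> : expR (r ^+ 6) = expR (r ^+ 6 / 2) ^+ 2 by rewrite -expRM_natl; congr expR; field.
  by apply: lerXn2r; rewrite ?nnegrE ?expR_ge0 ?expR_ge1Dx//; lra.
rewrite expRN ler_pdivrMr ?expR_gt0//.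
apply: le_trans h10 _; apply: le_trans h12 _.
by move: he; rewrite !expr2; move: (expR _) => e; nra.
Qed.

(** [tRe a m] and [tIm b m] are t Re psi and t Im psi on the half-line, where
    t = m^6: the natural variable is then [m * cbrt x], whose cube is
    sqrt t * x.  The suffixes 1 and 2 denote derivatives. *)
Definition tRe (a m x : R) : R := 4 * pi ^+ 2 * (m * cbrt x) ^+ 6 - a * m ^+ 2 * (m * cbrt x) ^+ 4.
Definition tIm (b m x : R) : R := b * m ^+ 2 * (m * cbrt x) ^+ 4.
Definition tRe1 (a m x : R) : R := m ^+ 6 * (8 * pi ^+ 2 * cbrt x ^+ 3 - 4 / 3 * a * cbrt x).
Definition tIm1 (b m x : R) : R := m ^+ 6 * (4 / 3 * b * cbrt x).
Definition tRe2 (a m x : R) : R := m ^+ 6 * (8 * pi ^+ 2 - 4 / 9 * a * (cbrt x ^+ 2)^-1).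
Definition tIm2 (b m x : R) : R := m ^+ 6 * (4 / 9 * b * (cbrt x ^+ 2)^-1).

Lemma is_derive_tRe (a m x : R) : 0 < x -> is_derive x 1 (tRe a m) (tRe1 a m x).
Proof.
move=> x0; have ds := is_derive_cbrt x0; have s0 := cbrt_gt0 x0.
by apply: is_derive_eq; rewrite /tRe1 /GRing.scale/=; field; rewrite gt_eqF.
Qed.

Lemma is_derive_tIm (b m x : R) : 0 < x -> is_derive x 1 (tIm b m) (tIm1 b m x).
Proof.
move=> x0; have ds := is_derive_cbrt x0; have s0 := cbrt_gt0 x0.
by apply: is_derive_eq; rewrite /tIm1 /GRing.scale/=; field; rewrite gt_eqF.
Qed.

Lemma is_derive_tRe1 (a m x : R) : 0 < x -> is_derive x 1 (tRe1 a m) (tRe2 a m x).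
Proof.
move=> x0; have ds := is_derive_cbrt x0; have s0 := cbrt_gt0 x0.
by apply: is_derive_eq; rewrite /tRe2 /GRing.scale/=; field; rewrite gt_eqF.
Qed.

Lemma is_derive_tIm1 (b m x : R) : 0 < x -> is_derive x 1 (tIm1 b m) (tIm2 b m x).
Proof.
move=> x0; have ds := is_derive_cbrt x0; have s0 := cbrt_gt0 x0.
by apply: is_derive_eq; rewrite /tIm2 /GRing.scale/=; field; rewrite gt_eqF.
Qed.

(** The destabilising term of order xi^(4/3) is absorbed by the Gaussian one:
    with r = m * cbrt x and A >= |a| m^2, A r^4 <= r^6 + A^3. *)
Lemma damping (a M : R) : 0 <= M -> exists2 C : R, 0 < C &
  forall m x : R, 0 < m -> m <= M -> 0 < x ->
    (1 + m * cbrt x) ^+ 10 * expR (- tRe a m x) <= C.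
Proof.
move=> M0; pose A := `|a| * M ^+ 2.
(* as 4 pi^2 >= 2, one r^6 absorbs A r^4 up to the constant A^3 and another
   one is left for [expR_sextic] *)
exists (2 ^+ 14 * expR (A ^+ 3)); first by rewrite mulr_gt0 ?expR_gt0.
move=> m x m0 mM x0; rewrite /tRe.
have : 0 < m * cbrt x by rewrite mulr_gt0 ?cbrt_gt0.
move: (m * cbrt x) => r r0.
have A0 : 0 <= A by rewrite mulr_ge0 ?normr_ge0// sqr_ge0.
have r2 : 0 <= r ^+ 2 by exact: sqr_ge0.
have r4 : 0 <= r ^+ 4 by rewrite exprn_ge0 ?ltW.
have r6 : 0 <= r ^+ 6 by rewrite exprn_ge0 ?ltW.
have ham : a * m ^+ 2 <= A.
  apply: le_trans (_ : `|a| * m ^+ 2 <= _).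
    by rewrite ler_wpM2r ?sqr_ge0// ler_norm.
  by rewrite ler_wpM2l// lerXn2r// nnegrE ltW.
have hA : A * r ^+ 4 <= r ^+ 6 + A ^+ 3.
  have [h|h] := leP A (r ^+ 2).
    have : A * r ^+ 4 <= r ^+ 2 * r ^+ 4 by exact: ler_wpM2r.
    by rewrite -exprD; have := exprn_ge0 3 A0; lra.
  have : A * (r ^+ 2) ^+ 2 <= A * A ^+ 2.
    by rewrite ler_wpM2l// lerXn2r// ?nnegrE// ltW.
  by rewrite -exprM -exprS; lra.
have pi2 : 2 <= 4 * pi ^+ 2 :> R.
  have := @pi_ge2 R => p2.
  have : 2 ^+ 2 <= (pi : R) ^+ 2 by rewrite lerXn2r// ?nnegrE; lra.
  by lra.
have le1 : expR (- (4 * pi ^+ 2 * r ^+ 6 - a * m ^+ 2 * r ^+ 4)) <= expR (- r ^+ 6) * expR (A ^+ 3).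
  rewrite -expRD ler_expR.
  have : 2 * r ^+ 6 <= 4 * pi ^+ 2 * r ^+ 6 by exact: ler_wpM2r.
  have : a * m ^+ 2 * r ^+ 4 <= A * r ^+ 4 by exact: ler_wpM2r.
  by lra.
apply: le_trans (_ : _ <= (1 + r) ^+ 10 * (expR (- r ^+ 6) * expR (A ^+ 3))) _.
  by rewrite ler_wpM2l// exprn_ge0; lra.
by rewrite mulrA ler_wpM2r ?expR_ge0// expR_sextic// ltW.
Qed.

End Damping.

Section OscillatoryIntegrals.
Context {R : realType}.
Local Notation mu := (@lebesgue_measure R).
Local Notation pos := (`]0, +oo[%classic : set R).

(** Domination by a multiple of [profile] gives at once integrability and a
    bound that is uniform in the scaling parameter. *)
Lemma integrable_le_profile (g : R -> R) (al w k : R) :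
  0 < al -> 0 < w -> 0 <= k ->
  (forall x : R, 0 < x -> {for x, continuous g}) ->
  (forall x : R, 0 < x -> `|g x| <= k * profile al w x) ->
  mu.-integrable pos (EFin \o g) /\ `|\int[mu]_(x in `]0, +oo[) g x| <= k.
Proof.
move=> al0 w0 k0 cg gk.
have mg : measurable_fun pos g by exact: continuous_pos_measurable.
have le : (\int[mu]_(x in `]0%R, +oo[) `|(g x)%:E| <= k%:E)%E.
  apply: (@le_trans _ _ (\int[mu]_(x in `]0%R, +oo[) (k%:E * (profile al w x)%:E))%E).
    apply: ge0_le_integral => //.
    - by apply: measurableT_comp => //; exact/measurable_EFinP.
    - apply: measurable_funeM; apply/measurable_EFinP.
      exact: (continuous_pos_measurable (fun x x0 => continuous_profile al0 w0 x0)).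
    - by move=> x /=; rewrite in_itv/= andbT => /gk; rewrite -EFinM lee_fin.
  rewrite ge0_integralZl//.
  - by rewrite -[leRHS]mule1 lee_wpmul2l ?lee_fin ?profile_integral.
  - apply/measurable_EFinP.
    exact: (continuous_pos_measurable (fun x x0 => continuous_profile al0 w0 x0)).
  - by move=> x _; rewrite lee_fin profile_ge0 //; exact: ltW.
have ig : mu.-integrable pos (EFin \o g).
  apply/integrableP; split; first exact/measurable_EFinP.
  by apply: le_lt_trans le _; rewrite ltry.
split => //; rewrite -lee_fin EFin_normr_Rintegral//.
apply: le_trans (le_abse_integral _ _ _) _ => //.
exact/measurable_EFinP.
Qed.

Variables a b M : R.
Hypothesis M0 : 0 <= M.

(** A common bound for the coefficients of the derivatives of t psi in terms of
    m * cbrt x. *)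
Definition coef_bound : R := 8 * pi ^+ 2 + 4 / 3 * (`|a| + `|b|) * M ^+ 2.

Local Notation L := coef_bound.

(** These are all the polynomial weights that multiply the damping factor; the
    factor [r ^+ 2] makes up for the singularity of [profile]. *)
Lemma weight_bounds (r : R) : 0 < r ->
  [/\ r ^+ 2 <= (1 + r) ^+ 8, r ^+ 3 * r ^+ 2 <= (1 + r) ^+ 8,
      r ^+ 2 * (1 + r ^+ 4 + r ^+ 6) <= (1 + r) ^+ 8,
      1 + r ^+ 2 <= (1 + r) ^+ 8 /\ r ^+ 2 * (r + r ^+ 3) <= (1 + r) ^+ 8 &
      r ^+ 2 * (r + r ^+ 3) ^+ 2 <= (1 + r) ^+ 8].
Proof.
move=> r0; have h k : 0 <= r ^+ k by rewrite exprn_ge0 ?ltW.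
have := h 1%N; have := h 2%N; have := h 3%N; have := h 4%N; have := h 5%N.
have := h 6%N; have := h 7%N; have := h 8%N => *.
split; try split; lra.
Qed.

(** The tenth power in [damping] is spent as follows: eight on the weight [g],
    two on the denominator of [profile]. *)
Lemma weighted_damping : exists2 C : R, 0 < C & forall m x g : R,
  0 < m -> m <= M -> 0 < x ->
  (m * cbrt x) ^+ 2 * g <= (1 + m * cbrt x) ^+ 8 ->
  g * expR (- tRe a m x) <= C / m ^+ 3 * profile 3^-1 m x.
Proof.
have [C C0 HC] := @damping R a M M0.
exists (3 * C) => [|m x g m0 mM x0]; first by rewrite mulr_gt0.
have {HC} := HC m x m0 mM x0.
rewrite /profile powR_thirdB1// -/(cbrt x).
move: (expR_gt0 (- tRe a m x)) (cbrt_gt0 x0); move: (expR _) (cbrt x) => E s E0 s0 HC Hg.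
have r0 : 0 < m * s by rewrite mulr_gt0.
have -> : 3 * C / m ^+ 3 * (3^-1 * m * (s ^+ 2)^-1 / (1 + m * s) ^+ 2) =
    C / ((m * s) ^+ 2 * (1 + m * s) ^+ 2).
  by field; rewrite ?(gt_eqF m0) ?(gt_eqF s0) ?gt_eqF//; lra.
move: (m * s) r0 HC Hg => r r0 HC Hg.
rewrite ler_pdivlMr; last by rewrite mulr_gt0// exprn_gt0//; lra.
apply: le_trans HC.
have -> : g * E * (r ^+ 2 * (1 + r) ^+ 2) = (r ^+ 2 * g) * (E * (1 + r) ^+ 2) by ring.
have -> : (1 + r) ^+ 10 * E = (1 + r) ^+ 8 * (E * (1 + r) ^+ 2) by ring.
by rewrite ler_wpM2r// mulr_ge0 ?sqr_ge0// ltW.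
Qed.

Lemma L_ge0 : 0 <= L.
Proof.
by rewrite /coef_bound !(sqr_ge0, addr_ge0, mulr_ge0, invr_ge0).
Qed.

Section Coefficients.
Variables m x : R.
Hypotheses (m0 : 0 < m) (mM : m <= M) (x0 : 0 < x).
Let r := m * cbrt x.

Let r_gt0 : 0 < r. Proof. by rewrite mulr_gt0 ?cbrt_gt0. Qed.

Let coefM (c : R) : 0 <= c -> c <= 4 / 3 ->
  c * `|a| * m ^+ 2 + c * `|b| * m ^+ 2 <= 4 / 3 * (`|a| + `|b|) * M ^+ 2.
Proof.
move=> c0 c1; rewrite -mulrDl -mulrDr.
have ab0 : 0 <= `|a| + `|b| by rewrite addr_ge0.
apply: le_trans (_ : c * (`|a| + `|b|) * M ^+ 2 <= _).
  by apply: ler_wpM2l; [exact: mulr_ge0|rewrite lerXn2r ?nnegrE// ltW].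
by apply: ler_wpM2r; [exact: sqr_ge0|exact: ler_wpM2r].
Qed.

Let pi0 : 0 <= 8 * pi ^+ 2 :> R. Proof. by rewrite mulr_ge0// sqr_ge0. Qed.

Lemma normr_tRe1 : `|tRe1 a m x| <= m ^+ 3 * (L * (r + r ^+ 3)).
Proof.
have -> : tRe1 a m x = m ^+ 3 * (8 * pi ^+ 2 * r ^+ 3 - 4 / 3 * (a * m ^+ 2) * r).
  by rewrite /tRe1 /r; ring.
rewrite normrM gtr0_norm ?exprn_gt0// ler_pM2l ?exprn_gt0//.
apply: le_trans (ler_normB _ _) _.
rewrite (@ger0_norm _ (_ * r ^+ 3)); last by apply: mulr_ge0 => //; exact/ltW/exprn_gt0.
rewrite 2!normrM [`|a * _|]normrM (gtr0_norm r_gt0) (gtr0_norm (exprn_gt0 2 m0)).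
rewrite [`|4 / 3|]ger0_norm ?divr_ge0//.
have h := coefM (_ : 0 <= 4 / 3) (lexx _).
have {h} h : 4 / 3 * `|a| * m ^+ 2 + 4 / 3 * `|b| * m ^+ 2 <= L.
  by apply: le_trans (h _) _; rewrite ?divr_ge0// /coef_bound lerDr.
have hb : 0 <= 4 / 3 * `|b| * m ^+ 2 by rewrite !(sqr_ge0, mulr_ge0, invr_ge0).
have hL : 8 * pi ^+ 2 <= L by rewrite /coef_bound lerDl !(sqr_ge0, addr_ge0, mulr_ge0, invr_ge0).
have r3 := exprn_gt0 3 r_gt0.
have := ler_wpM2r (ltW r3) hL.
have ha : 4 / 3 * (`|a| * m ^+ 2) <= L by lra.
have := ler_wpM2r (ltW r_gt0) ha.
lra.
Qed.

Lemma normr_tIm1 : `|tIm1 b m x| <= m ^+ 3 * (L * (r + r ^+ 3)).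
Proof.
have -> : tIm1 b m x = m ^+ 3 * (4 / 3 * (b * m ^+ 2) * r).
  by rewrite /tIm1 /r; ring.
rewrite normrM gtr0_norm ?exprn_gt0// ler_pM2l ?exprn_gt0//.
rewrite 2!normrM [`|b * _|]normrM (gtr0_norm r_gt0).
rewrite (gtr0_norm (exprn_gt0 2 m0)) [`|4 / 3|]ger0_norm ?divr_ge0//.
have h := coefM (_ : 0 <= 4 / 3) (lexx _).
have {h} h : 4 / 3 * `|a| * m ^+ 2 + 4 / 3 * `|b| * m ^+ 2 <= L.
  by apply: le_trans (h _) _; rewrite ?divr_ge0// /coef_bound lerDr.
have ha : 0 <= 4 / 3 * `|a| * m ^+ 2 by rewrite !(sqr_ge0, mulr_ge0, invr_ge0).
have hb : 4 / 3 * (`|b| * m ^+ 2) <= L by lra.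
have := ler_wpM2r (ltW r_gt0) hb.
have := mulr_ge0 L_ge0 (ltW (exprn_gt0 3 r_gt0)).
lra.
Qed.

Lemma normr_tRe2_tIm2 : r ^+ 2 * (`|tRe2 a m x| + `|tIm2 b m x|) <= m ^+ 6 * (L * (1 + r ^+ 2)).
Proof.
have s0 := cbrt_gt0 x0.
have -> : tRe2 a m x = m ^+ 6 * (8 * pi ^+ 2 - 4 / 9 * (a * m ^+ 2) * (r ^+ 2)^-1).
  by rewrite /tRe2 /r; field; rewrite !gt_eqF.
have -> : tIm2 b m x = m ^+ 6 * (4 / 9 * (b * m ^+ 2) * (r ^+ 2)^-1).
  by rewrite /tIm2 /r; field; rewrite !gt_eqF.
rewrite 2![`|m ^+ 6 * _|]normrM !(gtr0_norm (exprn_gt0 6 m0)) -mulrDr mulrCA ler_pM2l ?exprn_gt0//.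
rewrite mulrDr.
have r2 := exprn_gt0 2 r_gt0.
have absM (z : R) : r ^+ 2 * `|z| = `|r ^+ 2 * z| by rewrite normrM (gtr0_norm r2).
rewrite 2!absM.
have -> : r ^+ 2 * (8 * pi ^+ 2 - 4 / 9 * (a * m ^+ 2) * (r ^+ 2)^-1) =
  8 * pi ^+ 2 * r ^+ 2 - 4 / 9 * (a * m ^+ 2) by field; rewrite gt_eqF.
have -> : `|r ^+ 2 * (4 / 9 * (b * m ^+ 2) * (r ^+ 2)^-1)| = 4 / 9 * (`|b| * m ^+ 2).
  have -> : r ^+ 2 * (4 / 9 * (b * m ^+ 2) * (r ^+ 2)^-1) = 4 / 9 * (b * m ^+ 2).
    by field; rewrite gt_eqF.
  by rewrite normrM [`|b * _|]normrM (gtr0_norm (exprn_gt0 2 m0)) ger0_norm ?divr_ge0.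
have := ler_normB (8 * pi ^+ 2 * r ^+ 2) (4 / 9 * (a * m ^+ 2)).
rewrite (@ger0_norm _ (_ * r ^+ 2)); last by apply: mulr_ge0 => //; exact: ltW.
rewrite normrM [`|a * _|]normrM (gtr0_norm (exprn_gt0 2 m0)) [`|4 / 9|]ger0_norm ?divr_ge0// => hh.
have h := coefM (_ : 0 <= 4 / 9) (_ : 4 / 9 <= 4 / 3).
have {h} h : 4 / 9 * `|a| * m ^+ 2 + 4 / 9 * `|b| * m ^+ 2 <= L.
  by apply: le_trans (h _ _) _; rewrite ?divr_ge0 /coef_bound ?lerDr//; lra.
have hL : 8 * pi ^+ 2 <= L by rewrite /coef_bound lerDl !(sqr_ge0, addr_ge0, mulr_ge0, invr_ge0).
have := ler_wpM2r (ltW r2) hL.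
lra.
Qed.

End Coefficients.

End OscillatoryIntegrals.

(** * Oscillatory integrals *)

Section VanishingEnds.
Context {R : realType}.

(** Used to see that primitives dominated by [profile] vanish at infinity. *)
Lemma profile_le_inv (a w x : R) : 0 < a <= 1 -> 0 < w -> 0 < x -> profile a w x <= x^-1.
Proof.
move=> /andP[a0 a1] w0 x0; rewrite /profile powRB; last by rewrite (gt_eqF x0) implybT.
rewrite powRr1; last exact: ltW.
have -> : a * w * (x `^ a / x) = a * (w * x `^ a) / x by ring.
have : 0 < w * x `^ a by rewrite mulr_gt0 ?powR_gt0.
move: (w * x `^ a) => t t0.
have d0 : 0 < (1 + t) ^+ 2 by rewrite exprn_gt0//; lra.
rewrite ler_pdivrMr// [leLHS]mulrC ler_pM2l ?invr_gt0//.
have : a * t <= 1 * t by rewrite ler_pM2r.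
by rewrite expr2; nra.
Qed.

Lemma cvgy0_le_inv (F : R -> R) (K : R) : 0 <= K ->
  (forall x, 0 < x -> `|F x| <= K / x) -> F x @[x --> +oo] --> 0.
Proof.
move=> K0 FK; apply/cvgrPdist_lt => e e0; near=> x; rewrite sub0r normrN.
have x0 : 0 < x by near: x; exact: nbhs_pinfty_gt.
apply: le_lt_trans (FK _ x0) _; rewrite ltr_pdivrMr// mulrC -ltr_pdivrMr//.
by near: x; apply: nbhs_pinfty_gt; rewrite num_real.
Unshelve. all: end_near. Qed.

Lemma cvg0_cbrt (F G : R -> R) : {for 0, continuous G} -> G 0 = 0 ->
  (forall x, 0 < x -> F x = G (cbrt x)) -> F x @[x --> 0^'+] --> 0.
Proof.
move=> cG G0 FG.
have h : (G \o cbrt) x @[x --> 0^'+] --> 0.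
  by rewrite -[X in _ --> X]G0; apply: (cvg_comp _ _ cbrt_cvg0); exact: cG.
apply: cvg_trans h; apply: near_eq_cvg; near=> x.
by rewrite /= FG.
Unshelve. all: end_near. Qed.

End VanishingEnds.

Section OscillatoryBounds.
Context {R : realType}.
Local Notation mu := (@lebesgue_measure R).
Local Notation pos := (`]0, +oo[%classic : set R).
Variables a b : R.

(** Up to factors, [osc_cos] is the kernel at the frequency variable
    y = 2 pi x and [osc_sin] its derivative in x. *)
Definition osc_cos (m y : R) : R := \int[mu]_(x in `]0, +oo[) wave_cos (tRe a m) (tIm b m) y x.
Definition osc_sin (m y : R) : R := \int[mu]_(x in `]0, +oo[) (x * wave_sin (tRe a m) (tIm b m) y x).

(** What remains, besides the factors y and y^2, in the derivatives computed in
    [is_derive_one_part] and [is_derive_two_parts]. *)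
Definition one_part_remainder (m y x : R) : R :=
  (1 - x * tRe1 a m x) * wave_cos (tRe a m) (tIm b m) y x
  + x * tIm1 b m x * wave_sin (tRe a m) (tIm b m) y x.

Definition two_parts_remainder (m y x : R) : R :=
  (tRe2 a m x - tRe1 a m x ^+ 2 + tIm1 b m x ^+ 2) * wave_cos (tRe a m) (tIm b m) y x
  + (2 * tRe1 a m x * tIm1 b m x - tIm2 b m x) * wave_sin (tRe a m) (tIm b m) y x.

Lemma is_derive_continuous (f : R -> R) (x d : R) : is_derive x 1 f d -> continuous_at x f.
Proof. by move=> df; apply/differentiable_continuous/derivable1_diffP. Qed.

Lemma phase_continuous (m y x : R) : 0 < x ->
  [/\ continuous_at x (wave_cos (tRe a m) (tIm b m) y),
      continuous_at x (fun z : R => z * wave_cos (tRe a m) (tIm b m) y z),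
      continuous_at x (fun z : R => z * wave_sin (tRe a m) (tIm b m) y z),
      continuous_at x (one_part_remainder m y) & continuous_at x (two_parts_remainder m y)].
Proof.
move=> x0; have cs : continuous_at x cbrt by exact: continuous_cbrt.
have s0 : cbrt x ^+ 2 != 0 by rewrite gt_eqF// exprn_gt0// cbrt_gt0.
have c1 := is_derive_continuous (is_derive_tRe a m x0).
have c2 := is_derive_continuous (is_derive_tRe1 a m x0).
have c3 := is_derive_continuous (is_derive_tIm b m x0).
have c4 := is_derive_continuous (is_derive_tIm1 b m x0).
have c5 : continuous_at x (tRe2 a m) by rewrite /tRe2; fcont.
have c6 : continuous_at x (tIm2 b m) by rewrite /tIm2; fcont.
have cC : continuous_at x (wave_cos (tRe a m) (tIm b m) y) by rewrite /wave_cos; fcont.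
have cS : continuous_at x (wave_sin (tRe a m) (tIm b m) y) by rewrite /wave_sin; fcont.
by split; rewrite ?/one_part_remainder ?/two_parts_remainder; fcont.
Qed.

Variable M : R.
Hypothesis M0 : 0 <= M.
Local Notation rr m x := (m * cbrt x).

(** Every integrand and every primitive is a polynomial in r = m * cbrt x and
    1 / r times the damping factor, hence at most a multiple of [profile]; the
    powers of m in front are dictated by homogeneity.  The last bound shows
    that the primitive of the double integration by parts vanishes at
    infinity. *)
Lemma phase_bounds : exists2 C : R, 0 < C & forall m y x : R, 0 < m -> m <= M -> 0 < x ->
  [/\ `|wave_cos (tRe a m) (tIm b m) y x| <= C / m ^+ 3 * profile 3^-1 m x,
      `|x * expR (- tRe a m x)| <= C / m ^+ 6 * profile 3^-1 m x,
      `|one_part_remainder m y x| <= C / m ^+ 3 * profile 3^-1 m x,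
      `|two_parts_remainder m y x| <= C * m ^+ 3 * profile 3^-1 m x &
      `|tRe1 a m x * wave_cos (tRe a m) (tIm b m) y x
        - (y + tIm1 b m x) * wave_sin (tRe a m) (tIm b m) y x|
        <= C * (1 + `|y| / m ^+ 3) * profile 3^-1 m x].
Proof.
have [C0 C00 HC] := @weighted_damping R a M M0.
pose L := coef_bound a b M.
have L0 : 0 <= L by exact: L_ge0.
(* K exceeds the three constants that occur: 1 + 2 L for one integration
   by parts, L + 4 L^2 for two, and 2 L for the primitive *)
pose K := 1 + 4 * L + 4 * L ^+ 2.
have LL : 0 <= L ^+ 2 by exact: sqr_ge0.
exists (C0 * K); first by rewrite mulr_gt0// /K; lra.
move=> m y x m0 mM x0.
have s0 := cbrt_gt0 x0.
have r0 : 0 < rr m x by rewrite mulr_gt0.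
have x_r : x = rr m x ^+ 3 / m ^+ 3.
  by rewrite exprMn (cbrtK (ltW x0)); field; rewrite gt_eqF.
have [w1 w2 w3 [w4 w5] w6] := weight_bounds r0.
have nP := normr_tRe1 a b M0 m0 mM x0; have nQ := normr_tIm1 a b M0 m0 mM x0.
have nPQ := normr_tRe2_tIm2 a b M0 m0 mM x0.
have hw g := HC m x g m0 mM x0.
rewrite -/L in nP nQ nPQ.
have nc := normr_wave_cos (tRe a m) (tIm b m) y x.
have ns := normr_wave_sin (tRe a m) (tIm b m) y x.
have E0 : 0 < expR (- tRe a m x) := expR_gt0 _.
have p0 : 0 <= profile 3^-1 m x by rewrite profile_ge0// ?invr_ge0// ltW.
rewrite /one_part_remainder /two_parts_remainder.
move: (wave_cos _ _ _ _) (wave_sin _ _ _ _) (expR _) (profile _ _ _) nc ns E0 p0 hw.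
move=> c s E p nc ns E0 p0 hw.
move: (tRe1 _ _ _) (tIm1 _ _ _) nP nQ nPQ => P1 Q1 nP nQ nPQ.
move: (tRe2 _ _ _) (tIm2 _ _ _) nPQ => P2 Q2 nPQ.
move: (rr m x) r0 x_r w1 w2 w3 w4 w5 w6 nP nQ nPQ hw => r r0 xr w1 w2 w3 w4 w5 w6 nP nQ nPQ hw.
have m3 : 0 < m ^+ 3 by rewrite exprn_gt0.
have r2 : 0 < r ^+ 2 by rewrite exprn_gt0.
have r3 : 0 < r ^+ 3 by rewrite exprn_gt0.
have r4 : 0 < r ^+ 4 by rewrite exprn_gt0.
have r6 : 0 < r ^+ 6 by rewrite exprn_gt0.
pose q := C0 / m ^+ 3 * p.
have q0 : 0 <= q by rewrite /q !mulr_ge0// ?invr_ge0 ltW.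
have K1 : 1 <= K by rewrite /K; lra.
have scale (k g e : R) : e <= k * (g * E) -> r ^+ 2 * g <= (1 + r) ^+ 8 -> 0 <= k -> e <= k * q.
  by move=> he hg k0; apply: le_trans he _; rewrite ler_wpM2l// hw.
split.
- have -> : C0 * K / m ^+ 3 * p = K * q by rewrite /q; ring.
  apply: (scale K 1); rewrite ?mulr1 ?mul1r//; last by lra.
  by apply: le_trans nc _; rewrite ler_peMl// ltW.
- have -> : C0 * K / m ^+ 6 * p = K / m ^+ 3 * q by rewrite /q; field; rewrite gt_eqF.
  apply: (scale _ (r ^+ 3)).
  + rewrite ger0_norm ?mulr_ge0 ?(ltW E0) ?(ltW x0)// xr.
    have -> : r ^+ 3 / m ^+ 3 * E = (m ^+ 3)^-1 * (r ^+ 3 * E) by ring.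
    rewrite ler_wpM2r ?(mulr_ge0 (ltW r3) (ltW E0))//.
    by rewrite ler_peMl// invr_ge0 ltW.
  + by rewrite mulrC.
  + by rewrite divr_ge0// ?(ltW m3)//; lra.
- have -> : C0 * K / m ^+ 3 * p = K * q by rewrite /q; ring.
  apply: (scale K (1 + r ^+ 4 + r ^+ 6)) => //; last by lra.
  apply: le_trans (ler_normD _ _) _; rewrite !normrM.
  have hx (z : R) : `|z| <= m ^+ 3 * (L * (r + r ^+ 3)) -> `|x| * `|z| <= L * (r ^+ 4 + r ^+ 6).
    rewrite (gtr0_norm x0) => hz; apply: le_trans (ler_wpM2l (ltW x0) hz) _.
    by rewrite xr le_eqVlt; apply/orP; left; apply/eqP; field; rewrite gt_eqF.
  have h1 : `|1 - x * P1| <= 1 + L * (r ^+ 4 + r ^+ 6).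
    by apply: le_trans (ler_normB _ _) _; rewrite normr1 lerD2l normrM hx.
  have := ler_pM (normr_ge0 _) (normr_ge0 _) h1 nc.
  have := ler_pM (mulr_ge0 (normr_ge0 _) (normr_ge0 _)) (normr_ge0 _) (hx _ nQ) ns.
  have hK : (1 + 2 * (L * (r ^+ 4 + r ^+ 6))) * E <= K * ((1 + r ^+ 4 + r ^+ 6) * E).
    rewrite [leRHS]mulrA ler_wpM2r ?(ltW E0)// /K.
    have : 0 <= L * r ^+ 4 by rewrite mulr_ge0// ltW.
    have : 0 <= L * r ^+ 6 by rewrite mulr_ge0// ltW.
    have : 0 <= L ^+ 2 * r ^+ 4 by rewrite mulr_ge0// ltW.
    have : 0 <= L ^+ 2 * r ^+ 6 by rewrite mulr_ge0// ltW.
    by lra.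
  by lra.
- have -> : C0 * K * m ^+ 3 * p = m ^+ 6 * K * q by rewrite /q; field; rewrite gt_eqF.
  pose g1 := (1 + r ^+ 2) / r ^+ 2; pose g2 := (r + r ^+ 3) ^+ 2.
  have h1 : g1 * E <= q.
    apply: hw; rewrite /g1 mulrC divfK ?gt_eqF//.
  have h2 : g2 * E <= q by exact: hw.
  have m6 : 0 < m ^+ 6 by rewrite exprn_gt0.
  have hPQ : `|P2| + `|Q2| <= m ^+ 6 * L * g1.
    rewrite /g1 mulrA ler_pdivlMr// mulrC; apply: le_trans nPQ _; lra.
  pose B := m ^+ 3 * (L * (r + r ^+ 3)).
  have B0 : 0 <= B by exact: mulr_ge0 (ltW m3) (mulr_ge0 L0 (addr_ge0 (ltW r0) (ltW r3))).
  have BB : B ^+ 2 = m ^+ 6 * L ^+ 2 * g2 by rewrite /B /g2; ring.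
  have sq (z : R) : `|z| <= B -> `|z| ^+ 2 <= B ^+ 2 by move=> hz; rewrite lerXn2r// nnegrE.
  have hP := sq _ nP; have hQ := sq _ nQ.
  have hPQ1 : `|P1| * `|Q1| <= B ^+ 2 by rewrite expr2 ler_pM.
  apply: le_trans (ler_normD _ _) _; rewrite !normrM.
  have n1 : `|P2 - P1 ^+ 2 + Q1 ^+ 2| <= `|P2| + `|P1| ^+ 2 + `|Q1| ^+ 2.
    apply: le_trans (ler_normD _ _) _; rewrite normrX lerD2r.
    by apply: le_trans (ler_normB _ _) _; rewrite normrX.
  have n2 : `|2 * P1 * Q1 - Q2| <= 2 * (`|P1| * `|Q1|) + `|Q2|.
    by apply: le_trans (ler_normB _ _) _; rewrite !normrM gtr0_norm// mulrA.
  have := ler_pM (normr_ge0 _) (normr_ge0 _) n1 nc.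
  have := ler_pM (normr_ge0 _) (normr_ge0 _) n2 ns.
  have hS : (`|P2| + `|Q2| + 4 * B ^+ 2) * E <= m ^+ 6 * (L + 4 * L ^+ 2) * q.
    have e1 := ler_wpM2r (ltW E0) hPQ.
    have e2 := ler_wpM2l (mulr_ge0 (ltW m6) L0) h1.
    have e3 := ler_wpM2l (mulr_ge0 (ltW m6) LL) h2.
    by rewrite BB; lra.
  have hS2 : m ^+ 6 * (L + 4 * L ^+ 2) * q <= m ^+ 6 * K * q.
    by rewrite ler_wpM2r// ler_wpM2l ?(ltW m6)// /K; lra.
  have := ler_wpM2r (ltW E0) hP; have := ler_wpM2r (ltW E0) hQ.
  have := ler_wpM2r (ltW E0) hPQ1.
  move: hS hS2; move: (B ^+ 2) (m ^+ 6 * K * q) (m ^+ 6 * (L + 4 * L ^+ 2) * q) => b2 z1 z2.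
  by lra.
- have -> : C0 * K * (1 + `|y| / m ^+ 3) * p = K * (m ^+ 3 + `|y|) * q.
    by rewrite /q; field; rewrite gt_eqF.
  have h1 : (r + r ^+ 3) * E <= q by exact: hw.
  have h2 : E <= q by rewrite -[E]mul1r; apply: hw; rewrite mulr1.
  apply: le_trans (ler_normB _ _) _; rewrite !normrM.
  have := ler_pM (normr_ge0 _) (normr_ge0 _) (ler_normD y Q1) ns.
  have := ler_pM (normr_ge0 _) (normr_ge0 _) nP nc.
  have e1 := ler_wpM2r (ltW E0) nQ.
  have e2 := ler_wpM2l (normr_ge0 y) h2.
  have e3 := ler_wpM2l (mulr_ge0 (ltW m3) L0) h1.
  have : (2 * (m ^+ 3 * L) + `|y|) * q <= K * (m ^+ 3 + `|y|) * q.
    rewrite ler_wpM2r// /K.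
    have : 0 <= L * m ^+ 3 by rewrite mulr_ge0// ltW.
    have : 0 <= L ^+ 2 * m ^+ 3 by rewrite mulr_ge0// ltW.
    have : 0 <= L * `|y| by rewrite mulr_ge0.
    have : 0 <= L ^+ 2 * `|y| by rewrite mulr_ge0.
    by lra.
  by lra.
Qed.

End OscillatoryBounds.

Section OscillatoryDecay.
Context {R : realType}.
Local Notation mu := (@lebesgue_measure R).
Local Notation pos := (`]0, +oo[%classic : set R).
Variables a b M : R.
Hypothesis M0 : 0 <= M.

(** Used with [k = y] and [k = y ^+ 2]: powers of y times an oscillatory integral
    become integrals of remainders. *)
Lemma by_parts (F g1 g2 : R -> R) (k : R) :
  mu.-integrable pos (EFin \o g1) -> mu.-integrable pos (EFin \o g2) ->
  (forall x : R, 0 < x -> continuous_at x g1) -> (forall x : R, 0 < x -> continuous_at x g2) ->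
  (forall x : R, 0 < x -> is_derive x 1 F (g1 x - k * g2 x)) ->
  F x @[x --> 0^'+] --> 0 -> F x @[x --> +oo] --> 0 ->
  k * \int[mu]_(x in `]0, +oo[) g2 x = \int[mu]_(x in `]0, +oo[) g1 x.
Proof.
move=> i1 i2 c1 c2 dF F0 Fy.
have ik : mu.-integrable pos (EFin \o (fun x => k * g2 x)).
  rewrite (_ : EFin \o _ = (fun x => k%:E * (EFin \o g2) x)%E); last exact/funext.
  exact: integrableZl.
have i : mu.-integrable pos (EFin \o (fun x => g1 x - k * g2 x)).
  rewrite (_ : EFin \o _ = (EFin \o g1) \- (EFin \o (fun x => k * g2 x)%R))%E;
    last exact/funext.
  exact: integrableB.
have := @Rintegral_derive_vanishing R _ F _ dF i F0 Fy.
rewrite RintegralB// RintegralZl// => h; apply/esym/eqP; rewrite -subr_eq0; apply/eqP/h => x x0.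
have {}c1 := c1 x x0; have {}c2 := c2 x x0.
by change (continuous_at x (fun x => g1 x - k * g2 x)); fcont.
Qed.

(** In terms of t = m^6, the four bounds are of order t^(-1/2), t^(1/2), t^(-1)
    and t^(-1/2). *)
Lemma osc_bounds : exists2 C : R, 0 < C & forall m y : R, 0 < m -> m <= M ->
  [/\ `|osc_cos a b m y| <= C / m ^+ 3, y ^+ 2 * `|osc_cos a b m y| <= C * m ^+ 3,
      `|osc_sin a b m y| <= C / m ^+ 6 & `|y| * `|osc_sin a b m y| <= C / m ^+ 3].
Proof.
have [C C0 HC] := @phase_bounds R a b M M0; exists C => // m y m0 mM.
have third : 0 < 3^-1 :> R by rewrite invr_gt0.
have dom (g : R -> R) k : 0 <= k -> (forall x, 0 < x -> {for x, continuous g}) ->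
    (forall x, 0 < x -> `|g x| <= k * profile 3^-1 m x) ->
    mu.-integrable pos (EFin \o g) /\ `|\int[mu]_(x in `]0, +oo[) g x| <= k.
  by move=> k0 cg hg; exact: (integrable_le_profile third m0 k0 cg hg).
have m3 : 0 < m ^+ 3 by rewrite exprn_gt0.
have m6 : 0 < m ^+ 6 by rewrite exprn_gt0.
have [|||iC bC] := @dom (wave_cos (tRe a m) (tIm b m) y) (C / m ^+ 3).
- by rewrite divr_ge0 ?ltW.
- by move=> x x0; have [] := phase_continuous a b m y x0.
- by move=> x x0; have [] := HC m y x m0 mM x0.
have [|||iS bS] := @dom (fun x => x * wave_sin (tRe a m) (tIm b m) y x) (C / m ^+ 6).
- by rewrite divr_ge0 ?ltW.
- by move=> x x0; have [] := phase_continuous a b m y x0.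
- move=> x x0; have [_ h _ _ _] := HC m y x m0 mM x0; apply: le_trans h.
  rewrite 2![`|x * _|]normrM ler_wpM2l//; apply: le_trans (normr_wave_sin _ _ _ _) _.
  exact: ler_norm.
have [|||i1 b1] := @dom (one_part_remainder a b m y) (C / m ^+ 3).
- by rewrite divr_ge0 ?ltW.
- by move=> x x0; have [] := phase_continuous a b m y x0.
- by move=> x x0; have [] := HC m y x m0 mM x0.
have [|||i2 b2] := @dom (two_parts_remainder a b m y) (C * m ^+ 3).
- by rewrite mulr_ge0// ltW.
- by move=> x x0; have [] := phase_continuous a b m y x0.
- by move=> x x0; have [] := HC m y x m0 mM x0.
have prof_le x : 0 < x -> profile 3^-1 m x <= x^-1.
  by move=> x0; apply: profile_le_inv => //; rewrite third/= invf_le1// ler1n.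
have e1 : y * osc_sin a b m y = \int[mu]_(x in `]0, +oo[) one_part_remainder a b m y x.
  apply: (@by_parts (fun z => z * wave_cos (tRe a m) (tIm b m) y z)
    _ _ _ i1 iS).
  - by move=> x x0; have [] := phase_continuous a b m y x0.
  - by move=> x x0; have [] := phase_continuous a b m y x0.
  - move=> x x0.
    exact: is_derive_one_part (is_derive_tRe a m x0) (is_derive_tIm b m x0).
  - apply: (@cvg0_cbrt _ _ (fun s => s ^+ 3 *
      (expR (- (4 * pi ^+ 2 * (m * s) ^+ 6 - a * m ^+ 2 * (m * s) ^+ 4)) *
       cos (y * s ^+ 3 - b * m ^+ 2 * (m * s) ^+ 4)))).
    + by change (continuous_at (0 : R) (fun s : R => s ^+ 3 *
      (expR (- (4 * pi ^+ 2 * (m * s) ^+ 6 - a * m ^+ 2 * (m * s) ^+ 4)) *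
       cos (y * s ^+ 3 - b * m ^+ 2 * (m * s) ^+ 4)))); fcont.
    + by rewrite expr0n mul0r.
    + by move=> x x0; rewrite /wave_cos /tRe /tIm cbrtK// ltW.
  - apply: (@cvgy0_le_inv _ _ (C / m ^+ 6)) => [|x x0].
      by rewrite divr_ge0 ?ltW.
    have [_ h _ _ _] := HC m y x m0 mM x0.
    apply: le_trans (_ : _ <= C / m ^+ 6 * profile 3^-1 m x) _.
      apply: le_trans h.
      rewrite 2![`|x * _|]normrM ler_wpM2l//; apply: le_trans (normr_wave_cos _ _ _ _) _.
      exact: ler_norm.
    by rewrite ler_wpM2l ?prof_le// divr_ge0 ?ltW.
have e2 : y ^+ 2 * osc_cos a b m y = \int[mu]_(x in `]0, +oo[) two_parts_remainder a b m y x.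
  apply: (@by_parts (fun z => tRe1 a m z * wave_cos (tRe a m) (tIm b m) y z
      - (y + tIm1 b m z) * wave_sin (tRe a m) (tIm b m) y z) _ _ _ i2 iC).
  - by move=> x x0; have [] := phase_continuous a b m y x0.
  - by move=> x x0; have [] := phase_continuous a b m y x0.
  - move=> x x0.
    exact: (is_derive_two_parts _ (is_derive_tRe a m x0) (is_derive_tRe1 a m x0)
      (is_derive_tIm b m x0) (is_derive_tIm1 b m x0)).
  - pose G (s : R) :=
      m ^+ 6 * (8 * pi ^+ 2 * s ^+ 3 - 4 / 3 * a * s) *
      (expR (- (4 * pi ^+ 2 * (m * s) ^+ 6 - a * m ^+ 2 * (m * s) ^+ 4)) *
       cos (y * s ^+ 3 - b * m ^+ 2 * (m * s) ^+ 4))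
      - (y + m ^+ 6 * (4 / 3 * b * s)) *
      (expR (- (4 * pi ^+ 2 * (m * s) ^+ 6 - a * m ^+ 2 * (m * s) ^+ 4)) *
       sin (y * s ^+ 3 - b * m ^+ 2 * (m * s) ^+ 4)).
    apply: (@cvg0_cbrt _ _ G).
    + by change (continuous_at (0 : R) G); rewrite /G; fcont.
    + by rewrite /G !mulr0 !expr0n/= !mulr0 !subr0 sin0 !mulr0 mul0r subr0.
    + by move=> x x0; rewrite /wave_cos /wave_sin /tRe /tIm /tRe1 /tIm1 /G cbrtK// ltW.
  - have K0 : 0 <= C * (1 + `|y| / m ^+ 3).
      by rewrite mulr_ge0 ?(ltW C0)// addr_ge0// divr_ge0// ltW.
    apply: (@cvgy0_le_inv _ _ (C * (1 + `|y| / m ^+ 3))) => // x x0.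
    have [_ _ _ _ h] := HC m y x m0 mM x0.
    by apply: le_trans h _; rewrite ler_wpM2l ?prof_le.
split => //.
- by rewrite -[y ^+ 2]ger0_norm ?sqr_ge0// -normrM e2.
- by rewrite -normrM e1.
Qed.

End OscillatoryDecay.

(** * The kernel and its space derivative *)

Section KernelFormula.
Context {R : realType}.
Local Notation mu := (@lebesgue_measure R).
Local Notation pos := (`]0, +oo[%classic : set R).
Local Notation a := (@coef_a R).
Local Notation b := (@coef_b R).

Definition sixth (t : R) : R := t `^ 6^-1.

Lemma sixth_gt0 (t : R) : 0 < t -> 0 < sixth t.
Proof. exact: powR_gt0. Qed.

Lemma sixthK (t : R) : 0 <= t -> sixth t ^+ 6 = t.
Proof.
by move=> t0; rewrite /sixth -powR_mulrn ?powR_ge0// -powRrM mulVf// powRr1.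
Qed.

Lemma powR_four_thirds (z : R) : z `^ (4 / 3) = cbrt z ^+ 4.
Proof. by rewrite /cbrt -powR_mulrn ?powR_ge0// -powRrM mulrC. Qed.

(** Taking the real part of the inverse Fourier integral gives an even
    integrand, hence twice an integral on the half-line. *)
Lemma kernelE (t x : R) : 0 < t -> Defs.kernel t x = 2 * osc_cos a b (sixth t) (2 * pi * x).
Proof.
move=> t0.
pose f (z : R) := expR (- (t * complex.Re (psi_I z))) *
   cos (2 * pi * x * z - t * complex.Im (psi_I z)).
have -> : Defs.kernel t x = \int[mu]_z f z.
  rewrite /Defs.kernel /kernelC /inverse_fourier /cintegral /=.
  apply: eq_Rintegral => y _; rewrite /f /kernel_symbol /cexp /=.
  rewrite !mul0r ?subr0 ?addr0 expR0 !mul1r.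
  rewrite ?cosN ?sinN cosB. ring.
rewrite Rintegral_even; last 2 first.
- move=> z.
  have c2 : continuous_at z (fun y : R => `|y| `^ (4 / 3)) by exact: continuous_powR_norm.
  have c3 : continuous_at z (fun y : R => `|y| `^ (1 / 3)) by exact: continuous_powR_norm.
  by change (continuous_at z f); rewrite /f /psi_I /=; fcont.
- by move=> z; rewrite /f /= sqrrN normrN !mulNr !mulrN -opprD cosN.
congr (2 * _); apply: eq_Rintegral => z; rewrite inE/= in_itv/= andbT => z0.
rewrite /f /wave_cos /tRe /tIm /psi_I /= (gtr0_norm z0) powR_four_thirds.
have -> : z `^ (1 / 3) = cbrt z by rewrite div1r.
have := sixthK (ltW t0); have := cbrtK (ltW z0).
move: (cbrt z) (sixth t) => s m zs tm.
by congr (expR _ * cos _); rewrite -tm -zs; ring.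
Qed.

Variable t : R.
Hypothesis t0 : 0 < t.
Local Notation m := (sixth t).

(** Differentiation under the integral sign, the derivative of the integrand
    being dominated by 2 pi z exp (- t Re psi(z)) uniformly in x. *)
Lemma is_derive_osc_cos (x : R) :
  is_derive x 1 (fun y => osc_cos a b m (2 * pi * y)) (- (2 * pi * osc_sin a b m (2 * pi * x))).
Proof.
have m0 : 0 < m by exact: sixth_gt0.
have [C C0 HC] := @phase_bounds R a b m (ltW m0).
have third : 0 < 3^-1 :> R by rewrite invr_gt0.
have HCm y z := HC m y z m0 (lexx m).
have m3 : 0 < m ^+ 3 by rewrite exprn_gt0.
have m6 : 0 < m ^+ 6 by rewrite exprn_gt0.
have cont (y z : R) z0 := phase_continuous a b m y (z0 : 0 < z).
have dom k (g : R -> R) : 0 <= k -> (forall z : R, 0 < z -> continuous_at z g) ->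
    (forall z, 0 < z -> `|g z| <= k * profile 3^-1 m z) -> mu.-integrable pos (EFin \o g).
  by move=> k0 cg hg; have [] := integrable_le_profile third m0 k0 cg hg.
have iC y : mu.-integrable pos (EFin \o wave_cos (tRe a m) (tIm b m) y).
  apply: (dom (C / m ^+ 3)); first by rewrite divr_ge0 ?ltW.
  - by move=> z z0; have [] := cont y z z0.
  - by move=> z z0; have [] := HCm y z z0.
have iE : mu.-integrable pos (EFin \o (fun z => z * expR (- tRe a m z))).
  apply: (dom (C / m ^+ 6)); first by rewrite divr_ge0 ?ltW.
  - move=> z z0; have c1 := is_derive_continuous (is_derive_tRe a m z0).
    by change (continuous_at z (fun z => z * expR (- tRe a m z))); fcont.
  - by move=> z z0; have [] := HCm 0 z z0.
have leS y z : `|z * wave_sin (tRe a m) (tIm b m) y z| <= `|z * expR (- tRe a m z)|.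
  rewrite 2![`|z * _|]normrM ler_wpM2l//; apply: le_trans (normr_wave_sin _ _ _ _) _.
  exact: ler_norm.
have iS y : mu.-integrable pos (EFin \o (fun z => z * wave_sin (tRe a m) (tIm b m) y z)).
  apply: (dom (C / m ^+ 6)); first by rewrite divr_ge0 ?ltW.
  - by move=> z z0; have [] := cont y z z0.
  - by move=> z z0; apply: le_trans (leS _ _) _; have [] := HCm y z z0.
pose f (y z : R) : R := wave_cos (tRe a m) (tIm b m) (2 * pi * y) z.
pose df (y z : R) : R := - (2 * pi * (z * wave_sin (tRe a m) (tIm b m) (2 * pi * y) z)).
have dfE (y z : R) : is_derive y 1 (f ^~ z) (df y z).
  by apply: is_derive_eq; rewrite /df /wave_sin /GRing.scale/=; ring.
have dpart (y z : R) : partial1of2 f y z = df y z.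
  by rewrite /partial1of2 derive1E; have d := dfE y z; rewrite derive_val.
pose G (z : R) : R := 2 * pi * `|z * expR (- tRe a m z)|.
have pi0 : 0 <= 2 * pi :> R by rewrite mulr_ge0// pi_ge0.
have G0 (z : R) : 0 <= G z by rewrite mulr_ge0.
have iG : mu.-integrable pos (EFin \o G).
  rewrite (_ : EFin \o _ =
    (fun z => (2 * pi)%:E * (EFin \o (Num.norm \o (fun z => z * expR (- tRe a m z))%R)) z)%E);
    last exact/funext.
  by apply: integrableZl => //; exact: integrable_norm.
have derf (y z : R) : `]x - 1, x + 1[%classic y -> pos z -> derivable (f ^~ z) y 1.
  by move=> _ _; have d := dfE y z; exact: ex_derive.
have G_ub (y z : R) : `]x - 1, x + 1[%classic y -> pos z -> `|partial1of2 f y z| <= G z.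
  move=> _ _; rewrite dpart /df normrN /G normrM [`|2 * pi|]ger0_norm//.
  by apply: ler_wpM2l => //; exact: leS.
have xI : `]x - 1, x + 1[%classic x by rewrite /= in_itv/=; apply/andP; split; lra.
have intf (y : R) : `]x - 1, x + 1[%classic y -> mu.-integrable pos (EFin \o f y).
  by move=> _; exact: iC.
apply: DeriveDef.
  exact: (@derivable_under_integral R _ _ mu f pos (measurable_itv _)
    x (x - 1) (x + 1) xI intf derf G G0 iG G_ub).
rewrite -derive1E.
rewrite (@differentiation_under_integral R _ _ mu f pos (measurable_itv _)
    x (x - 1) (x + 1) xI intf derf G G0 iG G_ub).
rewrite -mulNr -RintegralZl//.
by apply: eq_Rintegral => z _; rewrite dpart /df mulNr.
Qed.

Lemma kernel_derive1 (x : R) :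
  derive1 (Defs.kernel t) x = - (4 * pi * osc_sin a b m (2 * pi * x)).
Proof.
have -> : Defs.kernel t = (fun x => 2 * osc_cos a b m (2 * pi * x)).
  by apply/funext => y; rewrite kernelE.
have d := is_derive_osc_cos x.
by rewrite derive1E derive_val /GRing.scale/=; ring.
Qed.

Lemma kernel_measurable : measurable_fun setT (Defs.kernel t).
Proof.
have -> : Defs.kernel t = (fun x => 2 * osc_cos a b m (2 * pi * x)).
  by apply/funext => y; rewrite kernelE.
apply: continuous_measurable_fun => x.
have c := is_derive_continuous (is_derive_osc_cos x).
by change (continuous_at x (fun x => 2 * osc_cos a b m (2 * pi * x))); fcont.
Qed.

End KernelFormula.

Section MeasurabilityCalculus.
Context {d : measure_display} {T : measurableType d} {R : realType}.
Implicit Types f g : T -> R.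

Lemma fmeasurableD f g : measurable_fun setT f -> measurable_fun setT g ->
  measurable_fun setT (fun z => f z + g z).
Proof. exact: measurable_funD. Qed.

Lemma fmeasurableM f g : measurable_fun setT f -> measurable_fun setT g ->
  measurable_fun setT (fun z => f z * g z).
Proof. exact: measurable_funM. Qed.

Lemma fmeasurableN f : measurable_fun setT f -> measurable_fun setT (fun z => - f z).
Proof. exact: measurable_funN. Qed.

Lemma fmeasurableX n f : measurable_fun setT f -> measurable_fun setT (fun z => f z ^+ n).
Proof. exact: measurable_funX. Qed.

Lemma fmeasurable_expR f : measurable_fun setT f -> measurable_fun setT (fun z => expR (f z)).
Proof. by move=> mf; exact: measurableT_comp (@measurable_expR R) mf. Qed.

Lemma fmeasurable_sin f : measurable_fun setT f -> measurable_fun setT (fun z => sin (f z)).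
Proof.
move=> mf; apply: measurableT_comp mf.
by apply: continuous_measurable_fun; exact: continuous_sin.
Qed.

Lemma fmeasurable_powR (p : R) f : measurable_fun setT f -> measurable_fun setT (fun z => f z `^ p).
Proof. by move=> mf; exact: measurableT_comp (@measurable_powR R p) mf. Qed.

Lemma fmeasurable_norm f : measurable_fun setT f -> measurable_fun setT (fun z => `|f z|).
Proof. by move=> mf; exact: measurableT_comp mf. Qed.

End MeasurabilityCalculus.

(** The counterpart of [fcont] for measurability. *)
Ltac fmeas := lazymatch goal with
  | |- measurable_fun _ (fun=> ?c) => exact: measurable_cst
  | |- measurable_fun _ (fun z => z) => exact: measurable_id
  | |- measurable_fun _ (fun z => @?f z + @?g z) =>
      apply: (@fmeasurableD _ _ _ f g); fmeas
  | |- measurable_fun _ (fun z => @?f z * @?g z) =>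
      apply: (@fmeasurableM _ _ _ f g); fmeas
  | |- measurable_fun _ (fun z => - @?f z) => apply: (@fmeasurableN _ _ _ f); fmeas
  | |- measurable_fun _ (fun z => @?f z ^+ ?n) => apply: (@fmeasurableX _ _ _ n f); fmeas
  | |- measurable_fun _ (fun z => (@?f z) `^ ?p) => apply: (@fmeasurable_powR _ _ _ p f); fmeas
  | |- measurable_fun _ (fun z => expR (@?f z)) => apply: (@fmeasurable_expR _ _ _ f); fmeas
  | |- measurable_fun _ (fun z => sin (@?f z)) => apply: (@fmeasurable_sin _ _ _ f); fmeas
  | |- measurable_fun _ (fun z => `|@?f z|) => apply: (@fmeasurable_norm _ _ _ f); fmeas
  | |- _ => try assumption
  end.

Section ParametricIntegral.
Context {d : measure_display} {T : measurableType d} {R : realType}.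
Local Notation mu := (@lebesgue_measure R).

(** Tonelli's theorem for the positive and negative parts, whose integrals may
    be infinite; [fine] is measurable on the extended reals. *)
Lemma measurable_Rintegral_param (f : T * R -> R) (D : set R) :
  measurable D -> measurable_fun setT f ->
  measurable_fun setT (fun x => \int[mu]_(z in D) f (x, z)).
Proof.
move=> mD mf.
pose g (p : T * R) : R := f p * \1_D p.2.
have mg : measurable_fun setT (EFin \o g).
  apply/measurable_EFinP/measurable_funM => //.
  by apply: measurableT_comp => //; exact: measurable_indic.
rewrite (_ : (fun _ => _) = fine \o
  (fun x => (\int[mu]_z ((EFin \o g)^\+ (x, z)) - \int[mu]_z ((EFin \o g)^\- (x, z)))%E)).
  apply: measurableT_comp => //; apply: emeasurable_funB.
  - apply: (@measurable_fun_fubini_tonelli_F _ _ _ _ R mu (EFin \o g)^\+%E) => //.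
    exact: measurable_funepos.
  - apply: (@measurable_fun_fubini_tonelli_F _ _ _ _ R mu (EFin \o g)^\-%E) => //.
    exact: measurable_funeneg.
apply/funext => x; rewrite Rintegral_mkcond /Rintegral/= integralE.
by congr (fine (_ - _)%E); apply: eq_integral => z _;
  rewrite ?funeposE ?funenegE /= patchE /g /= indicE; case: ifPn;
  rewrite ?mulr1 ?mulr0.
Qed.

End ParametricIntegral.

Section KernelBounds.
Context {R : realType}.
Local Notation mu := (@lebesgue_measure R).
Local Notation a := (@coef_a R).
Local Notation b := (@coef_b R).

Lemma measurable_osc_sin :
  measurable_fun setT (fun p : R * R => osc_sin a b (sixth p.1) (2 * pi * p.2)).
Proof.
pose f (q : (R * R) * R) : R := q.2 * wave_sin (tRe a (sixth q.1.1)) (tIm b (sixth q.1.1))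
   (2 * pi * q.1.2) q.2.
apply: (@measurable_Rintegral_param _ _ _ f) => //.
have m2 : measurable_fun setT (fun q : (R * R) * R => q.2) by exact: measurable_snd.
have m1 : measurable_fun setT (fun q : (R * R) * R => q.1.1).
  by apply: measurableT_comp => //; exact: measurable_fst.
have m3 : measurable_fun setT (fun q : (R * R) * R => q.1.2).
  by apply: measurableT_comp => //; exact: measurable_fst.
by rewrite /f /wave_sin /tRe /tIm /sixth /cbrt; fmeas.
Qed.

Lemma sixth_le (s t : R) : 0 <= s -> s <= t -> sixth s <= sixth t.
Proof.
move=> s0 st; apply: ge0_ler_powR; rewrite ?nnegrE ?invr_ge0//.
exact: le_trans st.
Qed.

(** The typical frequency t^(-1/2) at time t. *)
Definition freq (t : R) : R := (sixth t ^+ 3)^-1.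

Lemma freq_gt0 t : 0 < t -> 0 < freq t.
Proof. by move=> t0; rewrite invr_gt0 exprn_gt0// sixth_gt0. Qed.

(** The first bounds in [osc_bounds] are used for |x| <= t^(1/2), the second
    ones for |x| >= t^(1/2); adding them combines the two regimes. *)
Lemma kernel_bounds (T : R) : 0 < T -> exists2 C : R, 0 < C &
  forall t x : R, 0 < t -> t <= T ->
  `|Defs.kernel t x| <= C * freq t / (1 + freq t * `|x|) ^+ 2 /\
  `|derive1 (Defs.kernel t) x| <= C * freq t ^+ 2 / (1 + freq t * `|x|).
Proof.
move=> T0; have [C C0 HC] := @osc_bounds R a b (sixth T) (powR_ge0 _ _).
have pi1 : 1 <= pi :> R by have := @pi_ge2 R; lra.
exists (4 * (1 + pi) * C); first by rewrite !mulr_gt0//; lra.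
move=> t x t0 tT; have m0 := sixth_gt0 t0.
rewrite (kernelE _ t0) (kernel_derive1 t0).
have [h1 h2 h3 h4] := HC (sixth t) (2 * pi * x) m0 (sixth_le (ltW t0) tT).
have w0 := freq_gt0 t0.
have d0 : 0 < 1 + freq t * `|x| by rewrite ltr_pwDl// mulr_ge0// ltW.
have e1 : C / sixth t ^+ 3 = C * freq t by [].
have e2 : C / sixth t ^+ 6 = C * freq t ^+ 2.
  by rewrite /freq; field; rewrite gt_eqF.
have e3 : C * sixth t ^+ 3 = C / freq t by rewrite /freq invrK.
rewrite e1 in h1 h4; rewrite e2 in h3; rewrite e3 in h2.
have ax0 : 0 <= `|x| by [].
have x2 : (2 * pi * x) ^+ 2 = 4 * pi ^+ 2 * `|x| ^+ 2.
  by rewrite real_normK ?num_real//; ring.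
rewrite x2 in h2; rewrite !normrM (@ger0_norm _ 2)// (@ger0_norm _ pi) ?pi_ge0// in h4.
have p2 : 1 <= pi ^+ 2 :> R by rewrite expr_ge1//; lra.
split.
- rewrite ler_pdivlMr ?exprn_gt0// normrM (@ger0_norm _ 2)//.
  move: (`|osc_cos _ _ _ _|) (normr_ge0 (osc_cos a b (sixth t) (2 * pi * x))) h1 h2 => O O0 h1 h2.
  have h2' : (freq t * `|x|) ^+ 2 * O <= C * freq t.
    have -> : C * freq t = freq t ^+ 2 * (C / freq t) by field; rewrite gt_eqF.
    rewrite exprMn -mulrA ler_wpM2l ?sqr_ge0//; apply: le_trans h2.
    by rewrite -mulrA -[leLHS]mul1r ler_wpM2r ?(mulr_ge0 (sqr_ge0 _) O0)//; lra.
  have h5 : (1 + freq t * `|x|) ^+ 2 <= 2 * (1 + (freq t * `|x|) ^+ 2).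
    have := sqr_ge0 (1 - freq t * `|x|); rewrite !expr2; lra.
  have := ler_wpM2r O0 h5.
  have : 0 <= C * freq t by rewrite mulr_ge0// ltW.
  rewrite -(mulrA _ C); move: (C * freq t) h1 h2' => c h1 h2' c0.
  have : 8 * c <= 4 * (1 + pi) * c by rewrite ler_wpM2r//; lra.
  by lra.
- rewrite ler_pdivlMr// normrN normrM (@ger0_norm _ (4 * pi)); last by lra.
  move: (`|osc_sin _ _ _ _|) (normr_ge0 (osc_sin a b (sixth t) (2 * pi * x))) h3 h4 => O O0 h3 h4.
  have c0 : 0 <= C * freq t ^+ 2 by rewrite mulr_ge0 ?sqr_ge0// ltW.
  have h3' := ler_wpM2l (pi_ge0 R) h3.
  have := ler_wpM2l (ltW w0) h4.
  have -> : freq t * (C * freq t) = C * freq t ^+ 2 by ring.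
  rewrite -(mulrA _ C); move: (C * freq t ^+ 2) c0 h3' => c c0 h3' h4'.
  by lra.
Qed.

End KernelBounds.

(** * Cauchy-Schwarz and Young inequalities *)

Section Reflection.
Context {R : realType}.
Local Notation mu := (@lebesgue_measure R).
Local Open Scope ereal_scope.

(** Lebesgue measure is determined by its values on intervals. *)
Lemma lebesgue_measure_reflect (c : R) (A : set R) : measurable A ->
  pushforward mu ((fun x => c - x)%R : _ -> measurableTypeR R) A = mu A.
Proof.
move=> mA; apply/esym/lebesgue_measure_unique => //= [|_ _ [[a b]] _ <-].
  have : measurable_fun setT (fun x : R => c - x)%R by fmeas.
  exact.
  rewrite /pushforward (_ : _ @^-1` _ = [set` `[c - b, c - a[%R]); last first.
    by apply/seteqP; split => x /=; rewrite !in_itv/= => /andP[h1 h2]; apply/andP; split; lra.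
  rewrite !lebesgue_measure_itv/= !lte_fin ltrD2l ltrN2.
  by case: ifP => // _; congr EFin; ring.
Qed.

Lemma ge0_integral_reflect (c : R) (f : R -> \bar R) :
  measurable_fun [set: R] f -> (forall x, 0 <= f x) ->
  \int[mu]_x f (c - x)%R = \int[mu]_x f x.
Proof.
move=> mf f0.
have mphi : measurable_fun setT ((fun x => c - x)%R : R -> measurableTypeR R).
  have : measurable_fun setT (fun x : R => c - x)%R by fmeas.
  exact.
transitivity (\int[mu]_(x in ((fun x => c - x)%R : _ -> measurableTypeR R) @^-1` setT)
    (f \o (fun x => c - x)%R) x); first by rewrite preimage_setT.
rewrite -ge0_integral_pushforward//=.
by apply: eq_measure_integral => //= A mA AS; exact: lebesgue_measure_reflect.
Qed.

End Reflection.

Section Envelope.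
Context {R : realType}.
Local Notation mu := (@lebesgue_measure R).

(** The majorant of the kernel, up to normalisation; its integral is of order
    1 / w. *)
Definition envelope (w x : R) : R := ((1 + w * `|x|) ^+ 2)^-1.

Lemma envelope_ge0 (w x : R) : 0 <= envelope w x.
Proof. by rewrite invr_ge0 sqr_ge0. Qed.

Lemma envelope_continuous (w : R) : 0 < w -> continuous (envelope w).
Proof.
move=> w0 x; have d0 : 0 < 1 + w * `|x| by rewrite ltr_pwDl// mulr_ge0// ltW.
have cn : continuous_at x (@Num.norm R R) by exact: norm_continuous.
change (continuous_at x (envelope w)); rewrite /envelope; fcont.
by rewrite gt_eqF// exprn_gt0.
Qed.

Lemma envelope_integral (w : R) : 0 < w ->
  (\int[mu]_x (envelope w x)%:E <= (2 / w)%:E)%E.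
Proof.
move=> w0.
rewrite ge0_symfun_integralT; last 3 first.
- exact: envelope_ge0.
- exact: envelope_continuous.
- by move=> x; rewrite /envelope/= normrN.
rewrite EFinM lee_pmul2l// -set_itvcy -integral_itv_obnd_cbnd; last first.
  apply/measurable_EFinP/measurable_funTS.
  by apply: continuous_measurable_fun; exact: envelope_continuous.
(* a primitive of the envelope on the half-line, bounded by 1 / w *)
apply: (@ge0_integral_bounded_primitive _ _ (fun x => w^-1 * (1 - (1 + w * x)^-1))) => x x0.
- exact: envelope_ge0.
- exact: envelope_continuous.
- have dn : 0 < 1 + w * x by rewrite ltr_pwDl// mulr_ge0// ltW.
  have dn0 : 1 + w * x != 0 by rewrite gt_eqF.
  have d1 : is_derive x 1 (fun z : R => 1 + w * z) w.
    by apply: is_derive_eq; rewrite /GRing.scale/=; ring.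
  have d2 := @is_deriveV _ (fun z : R => 1 + w * z) x _ _ dn0 d1.
  apply: is_derive_eq; rewrite /envelope (gtr0_norm x0) /GRing.scale/=; field.
  by rewrite dn0 (gt_eqF w0).
- have dn : 1 <= 1 + w * x by rewrite lerDl mulr_ge0// ltW.
  have i1 : (1 + w * x)^-1 <= 1 by rewrite invf_le1//; lra.
  have i0 : 0 <= (1 + w * x)^-1 by rewrite invr_ge0; lra.
  rewrite mulr_ge0 ?invr_ge0 ?(ltW w0)//=; last by lra.
  by rewrite ler_piMr ?invr_ge0 ?(ltW w0)//; lra.
Qed.

End Envelope.

Section WeightedCauchySchwarz.
Context d (T : measurableType d) {R : realType} (mu : {measure set T -> \bar R}).
Local Open Scope ereal_scope.

Lemma Lnorm2_sqr (f : T -> R) :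
  'N[mu]_2%:E[EFin \o f] * 'N[mu]_2%:E[EFin \o f] = \int[mu]_x ((f x) ^+ 2)%:E.
Proof.
have sqE (x : \bar R) : 0 <= x -> x * x = x `^ 2.
  case: x => [r| |]//; last by rewrite mulyy poweRyr ?pnatr_eq0.
  by rewrite lee_fin => r0; rewrite poweR_EFin -EFinM powR_mulrn.
rewrite sqE ?Lnorm_ge0// poweR_Lnorm ?pnatr_eq0//.
apply: eq_integral => x _ /=.
by rewrite powR_mulrn// real_normK ?num_real.
Qed.

(** Hoelder's inequality for p sqrt(q) and sqrt(q).  This asymmetric form is the
    one that yields both Young's inequality and the estimate of the Duhamel
    term. *)
Lemma cauchy_schwarz (p q : T -> R) :
  measurable_fun setT p -> measurable_fun setT q ->
  (forall x, 0 <= p x)%R -> (forall x, 0 <= q x)%R ->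
  (\int[mu]_x (p x * q x)%:E) * (\int[mu]_x (p x * q x)%:E) <=
  (\int[mu]_x (p x ^+ 2 * q x)%:E) * (\int[mu]_x (q x)%:E).
Proof.
move=> mp mq p0 q0.
pose s (x : T) : R := (q x `^ 2^-1)%R.
have ms : measurable_fun setT s by exact: fmeasurable_powR.
have s2 x : (s x ^+ 2 = q x)%R.
  by rewrite /s -powR_mulrn ?powR_ge0// -powRrM mulVf// powRr1.
have s0 x : (0 <= s x)%R by exact: powR_ge0.
have mps : measurable_fun setT (fun x => p x * s x)%R by exact: measurable_funM.
have h := @hoelder _ T R mu (fun x => p x * s x)%R s 2 2 mps ms.
have {h} h : \int[mu]_x (p x * q x)%:E <=
    'N[mu]_2%:E[EFin \o (fun x => p x * s x)%R] * 'N[mu]_2%:E[EFin \o s].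
  apply: le_trans (h _ _ _); rewrite ?ltr0n//; last by field.
  rewrite Lnorm1 le_eqVlt; apply/orP; left; apply/eqP.
  apply: eq_integral => x _; rewrite /= -mulrA -expr2 s2 ger0_norm// mulr_ge0//.
have I0 : 0 <= \int[mu]_x (p x * q x)%:E.
  by apply: integral_ge0 => x _; rewrite lee_fin mulr_ge0.
apply: le_trans (lee_pmul I0 I0 h h) _.
rewrite muleACA !Lnorm2_sqr.
by under eq_integral do rewrite exprMn s2; under [X in _ * X]eq_integral do rewrite s2.
Qed.

End WeightedCauchySchwarz.

Section Young.
Context {R : realType}.
Local Notation mu := (@lebesgue_measure R).
Local Open Scope ereal_scope.

Lemma ge0_integral_shift (c : R) (f : R -> \bar R) :
  measurable_fun [set: R] f -> (forall x, 0 <= f x) ->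
  \int[mu]_x f (x - c)%R = \int[mu]_x f x.
Proof.
move=> mf f0.
have mg : measurable_fun [set: R] (fun x => f (x - c)%R).
  apply: measurableT_comp => //.
  by have : measurable_fun setT (fun x : R => x - c)%R by fmeas.
rewrite -(ge0_integral_reflect 0 mg)// -(ge0_integral_reflect (- c) mf)//.
by apply: eq_integral => x _; congr f; ring.
Qed.

(** When the integral of [f] is infinite the left-hand side is the default
    value 0. *)
Lemma abs_Rintegral_le d (T : measurableType d) (m : {measure set T -> \bar R})
    (D : set T) (f : T -> R) : measurable D -> measurable_fun D f ->
  (`|\int[m]_(x in D) f x|)%:E <= \int[m]_(x in D) (`|f x|)%:E.
Proof.
move=> mD mf; rewrite /Rintegral.
apply: le_trans (_ : `|\int[m]_(x in D) (f x)%:E| <= _).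
  by case: (integral _ _ _) => [r| |]//=; rewrite normr0 leey.
exact/le_abse_integral/measurable_EFinP.
Qed.

Lemma measurable_sub_fun (f g : R -> R) : measurable_fun setT f -> measurable_fun setT g ->
  measurable_fun setT (fun p : R * R => f (p.1 - p.2) * g p.2)%R.
Proof.
move=> mf mg; apply: measurable_funM.
  apply: measurableT_comp => //.
  by apply: measurable_funB; [exact: measurable_fst|exact: measurable_snd].
by apply: measurableT_comp => //; exact: measurable_snd.
Qed.

(** Cauchy-Schwarz with weight E(x - y) dy bounds the squared convolution by
    A times the convolution of E with f^2, which Tonelli's theorem integrates. *)
Lemma young (E f : R -> R) (A : R) :
  measurable_fun setT E -> (forall x, 0 <= E x)%R ->
  \int[mu]_x (E x)%:E <= A%:E -> measurable_fun setT f -> (forall x, 0 <= f x)%R ->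
  \int[mu]_x ((\int[mu]_y (f y * E (x - y))%:E) * (\int[mu]_y (f y * E (x - y))%:E))
  <= A%:E * (A%:E * \int[mu]_x (f x ^+ 2)%:E).
Proof.
move=> mE E0 EA mf f0.
have A0 : 0 <= A%:E.
  by apply: le_trans EA; apply: integral_ge0 => x _; rewrite lee_fin.
have mEx (x : R) : measurable_fun setT (fun y : R => E (x - y))%R.
  apply: measurableT_comp => //.
  by have : measurable_fun setT (fun y : R => x - y)%R by fmeas.
have mf2 : measurable_fun setT (fun y => f y ^+ 2)%R by exact: measurable_funX.
pose F (p : R * R) : \bar R := (E (p.1 - p.2) * f p.2 ^+ 2)%:E.
have mF : measurable_fun setT F.
  by apply/measurable_EFinP; exact: (measurable_sub_fun mE mf2).
have F0 p : 0 <= F p by rewrite lee_fin mulr_ge0// sqr_ge0.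
have refl (x : R) : \int[mu]_y (E (x - y))%:E = \int[mu]_y (E y)%:E.
  exact: (ge0_integral_reflect x (measurableT_comp (@EFin_measurable R setT) mE)).
have step (x : R) : (\int[mu]_y (f y * E (x - y))%:E) * (\int[mu]_y (f y * E (x - y))%:E)
    <= A%:E * \int[mu]_y F (x, y).
  apply: le_trans (cauchy_schwarz mu mf (mEx x) f0 (fun y => E0 _)) _.
  rewrite muleC; apply: lee_pmul.
  - by apply: integral_ge0 => y _; rewrite lee_fin.
  - by apply: integral_ge0 => y _; rewrite lee_fin mulr_ge0// sqr_ge0.
  - by rewrite refl.
  - by under eq_integral do rewrite mulrC.
have mG : measurable_fun setT (fun x => \int[mu]_y F (x, y)).
  exact: measurable_fun_fubini_tonelli_F.
apply: le_trans (_ : \int[mu]_x (A%:E * \int[mu]_y F (x, y)) <= _).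
  apply: ge0_le_integral => //.
  - by move=> x _; apply: mule_ge0; apply: integral_ge0 => y _; rewrite lee_fin mulr_ge0.
  - have mJ : measurable_fun setT (fun x : R => \int[mu]_y (f y * E (x - y))%:E).
      apply: (@measurable_fun_fubini_tonelli_F _ _ _ _ R mu
        (fun p : R * R => (f p.2 * E (p.1 - p.2))%:E)) => [|p]; last by rewrite lee_fin mulr_ge0.
      apply/measurable_EFinP; under eq_fun do rewrite mulrC.
      exact: measurable_sub_fun.
    exact: emeasurable_funM.
  - exact: measurable_funeM.
rewrite ge0_integralZl//; last by move=> x _; apply: integral_ge0.
apply: lee_wpmul2l => //.
rewrite (@fubini_tonelli _ _ _ _ R mu mu F)//.
rewrite -ge0_integralZl//; last 2 first.
- exact/measurable_EFinP.
- by move=> x _; rewrite lee_fin sqr_ge0.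
apply: ge0_le_integral => //.
- by move=> y _; apply: integral_ge0.
- exact: measurable_fun_fubini_tonelli_G.
- by apply: measurable_funeM; apply/measurable_EFinP.
- move=> y _; rewrite /F/=.
  under eq_integral do rewrite EFinM.
  rewrite ge0_integralZr//.
  + apply: lee_wpmul2r; first by rewrite lee_fin sqr_ge0.
    by rewrite (@ge0_integral_shift y (EFin \o E))//; apply: measurableT_comp.
  + apply: measurableT_comp => //; apply: measurableT_comp => //.
    by have : measurable_fun setT (fun x : R => x - y)%R by fmeas.
  + by move=> x _; rewrite lee_fin.
  + by rewrite lee_fin sqr_ge0.
Qed.

End Young.

(** * The Duhamel integral *)

Section TimeWeight.
Context {R : realType}.
Local Notation mu := (@lebesgue_measure R).
Local Open Scope ereal_scope.

(** With z = w s^(1/4), this is (1 + z)^2 <= 4 (1 + z^4) <= 4 exp (z^4). *)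
Lemma expR_le_profile (w s : R) : (0 < w)%R -> (0 < s)%R ->
  (s `^ (- (3 / 4)) * expR (- (w ^+ 4 * s)) <= 16 / w * profile 4^-1 w s)%R.
Proof.
move=> w0 s0; have r4 : ((s `^ 4^-1) ^+ 4 = s)%R.
  by rewrite -powR_mulrn ?powR_ge0// -powRrM mulVf// powRr1// ltW.
rewrite /profile (_ : 4^-1 - 1 = - (3 / 4))%R; last by field.
have := powR_gt0 4^-1 s0; have := powR_gt0 (- (3 / 4)) s0.
move: (s `^ 4^-1)%R (s `^ (- (3 / 4)))%R r4 => r p r4 p0 r0.
have -> : (16 / w * (4^-1 * w * p / (1 + w * r) ^+ 2) = p * (4 / (1 + w * r) ^+ 2))%R.
  have : (0 < w * r)%R by rewrite mulr_gt0.
  move=> wr; field; rewrite (gt_eqF w0) gt_eqF//; lra.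
rewrite ler_pM2l//.
have -> : (w ^+ 4 * s = (w * r) ^+ 4)%R by rewrite -r4 exprMn.
have : (0 < w * r)%R by rewrite mulr_gt0.
move: (w * r)%R => z z0.
have d0 : (0 < (1 + z) ^+ 2)%R by rewrite exprn_gt0//; lra.
rewrite expRN ler_pdivlMr//.
rewrite mulrC ler_pdivrMr ?expR_gt0//.
have he := expR_ge1Dx (z ^+ 4).
have : ((1 + z) ^+ 2 <= 4 * (1 + z ^+ 4))%R.
  have := exprn_ge0 4 (ltW z0); have := sqr_ge0 (z ^+ 2 - 1)%R; have := sqr_ge0 (z - 1)%R.
  by lra.
by lra.
Qed.

(** After s is changed into t - s, the integrand is exp (w^4 t) times the
    function bounded in [expR_le_profile].  The gain 1 / w, that is
    lambda^(-1/4) with lambda = w^4, is what makes the Gronwall argument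
    close. *)
Lemma weight_integral (t w : R) : (0 < w)%R ->
  \int[mu]_(s in `]0%R, t[) ((t - s) `^ (- (3 / 4)) * expR (w ^+ 4 * s))%:E
  <= (expR (w ^+ 4 * t) * (16 / w))%:E.
Proof.
move=> w0.
pose g (s : R) := (s `^ (- (3 / 4)) * expR (w ^+ 4 * (t - s)))%:E.
have mg : measurable_fun [set: R] g.
  apply/measurable_EFinP.
  by change (measurable_fun setT (fun s : R => s `^ (- (3 / 4)) * expR (w ^+ 4 * (t - s)))%R); fmeas.
have mgD : measurable_fun [set: R] (g \_ `]0%R, t[).
  by apply/(measurable_restrictT _ _).1 => //; exact: measurable_funTS.
have g0 x : 0 <= (g \_ `]0%R, t[) x.
  by rewrite patchE; case: ifP => // _; rewrite lee_fin mulr_ge0 ?powR_ge0 ?expR_ge0.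
apply: le_trans (_ : \int[mu]_(s in `]0%R, t[) g s <= _).
  rewrite integral_mkcond [leRHS]integral_mkcond -(ge0_integral_reflect t mgD g0).
  rewrite le_eqVlt; apply/orP; left; apply/eqP; apply: eq_integral => s _.
  rewrite !patchE; have -> : ((t - s)%R \in `]0%R, t[%classic) = (s \in `]0%R, t[%classic).
    by apply/idP/idP; rewrite !inE/= !in_itv/= => /andP[h1 h2]; apply/andP; split; lra.
  by case: ifP => // _; rewrite /g subKr.
have gp (s : R) : (0 < s)%R -> g s <= (expR (w ^+ 4 * t) * (16 / w))%:E * (profile 4^-1 w s)%:E.
  move=> s0; rewrite /g -EFinM lee_fin mulrBr expRD mulrCA -[leRHS](mulrA (expR _)).
  by rewrite ler_wpM2l ?expR_ge0// expR_le_profile.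
have k0 : (0 <= expR (w ^+ 4 * t) * (16 / w))%R.
  by rewrite mulr_ge0 ?expR_ge0// divr_ge0// ltW.
have quarter : (0 < 4^-1 :> R)%R by rewrite invr_gt0.
have mp : measurable_fun (`]0%R, +oo[%classic : set R) (EFin \o profile 4^-1 w).
  apply/measurable_EFinP.
  exact: (continuous_pos_measurable (fun x x0 => continuous_profile quarter w0 x0)).
apply: le_trans (_ : \int[mu]_(s in `]0%R, +oo[) g s <= _).
  apply: ge0_subset_integral => //.
  - exact: measurable_funTS.
  - by move=> x _; rewrite lee_fin mulr_ge0 ?powR_ge0 ?expR_ge0.
  - by move=> x /=; rewrite !in_itv/= andbT => /andP[].
apply: le_trans (_ : \int[mu]_(s in `]0%R, +oo[)
   ((expR (w ^+ 4 * t) * (16 / w))%:E * (profile 4^-1 w s)%:E) <= _).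
  apply: ge0_le_integral => //.
  - by move=> x _; rewrite lee_fin mulr_ge0 ?powR_ge0 ?expR_ge0.
  - exact: measurable_funTS.
  - exact: measurable_funeM.
  - by move=> x /=; rewrite in_itv/= andbT => x0; exact: gp.
rewrite ge0_integralZl//; last first.
  by move=> x _; rewrite lee_fin profile_ge0//; exact: ltW.
by rewrite -[leRHS]mule1 lee_wpmul2l ?lee_fin ?profile_integral.
Qed.

End TimeWeight.

Section LebesguePlane.
Context {R : realType}.
Local Notation mu := (@lebesgue_measure R).

(** A named copy of the product measure, so that it carries its own sigma-finite
    structure and Tonelli's theorem applies between it and the line. *)
Definition lebesgue2 : set (measurableTypeR R * measurableTypeR R)%type -> \bar R := (mu \x mu)%E.

HB.instance Definition _ := Measure.on lebesgue2.

Lemma lebesgue2_sigma_finite : sigma_finite setT lebesgue2.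
Proof.
have /sigma_finiteP[F [TF ndF Foo]] := sigma_finiteT mu.
exists (fun n => F n `*` F n) => [|k].
  rewrite -setXTT TF predeqE => -[x y]; split => [[/= [n _ Fnx] [k _ Fky]]|[n _ [? ?]]].
    exists (maxn n k) => //; split.
      by move: x Fnx; exact/subsetPset/ndF/leq_maxl.
    by move: y Fky; exact/subsetPset/ndF/leq_maxr.
  by split; exists n.
have [mF Fk] := Foo k; split; first exact: measurableX.
by rewrite /lebesgue2 product_measure1E// lte_mul_pinfty// ge0_fin_numE.
Qed.

HB.instance Definition _ := Measure_isSigmaFinite.Build _ _ _ lebesgue2 lebesgue2_sigma_finite.

Lemma lebesgue2_tonelli (F : R * R -> \bar R) :
  measurable_fun setT F -> (forall z, 0 <= F z)%E ->
  (\int[lebesgue2]_q F q = \int[mu]_x \int[mu]_y F (x, y))%E.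
Proof. by move=> mF F0; exact: (@fubini_tonelli1 _ _ _ _ R mu mu F). Qed.

End LebesguePlane.

Section Duhamel.
Context {R : realType}.
Local Notation mu := (@lebesgue_measure R).
Local Notation mu2 := (@lebesgue2 R).
Local Open Scope ereal_scope.
Variables (kap : R * R -> R) (T Dk : R).
Hypothesis mkap : measurable_fun setT kap.
Hypothesis kapL2 : forall t : R, (0 < t)%R -> (t <= T)%R ->
  \int[mu]_x (kap (t, x) ^+ 2)%:E <= (Dk * t `^ (- (3 / 2)))%:E.
Hypothesis Dk0 : (0 <= Dk)%R.

(** [kap] stands for the space derivative of the kernel.  The absolute value
    makes Tonelli's theorem applicable before any convergence is known. *)
Definition duhamel (t : R) (N : R * R -> R) (x : R) : \bar R :=
  \int[mu2]_q (`|kap (t - q.1, x - q.2) * N q|)%:E.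

Lemma measurable_duhamel_integrand (t : R) (N : R * R -> R) : measurable_fun setT N ->
  measurable_fun setT (fun z : R * (R * R) => kap (t - z.2.1, z.1 - z.2.2) * N z.2)%R.
Proof.
move=> mN; apply: measurable_funM.
  apply: measurableT_comp => //; apply/measurable_fun_pair.
  - apply: measurable_funB => //.
    by apply: measurableT_comp; [exact: measurable_fst|exact: measurable_snd].
  - apply: measurable_funB; first exact: measurable_fst.
    by apply: measurableT_comp; [exact: measurable_snd|exact: measurable_snd].
by apply: measurableT_comp => //; exact: measurable_snd.
Qed.

Lemma measurable_duhamel (t : R) (N : R * R -> R) : measurable_fun setT N ->
  measurable_fun setT (duhamel t N).
Proof.
move=> mN.
pose F (z : R * (R * R)) : \bar R := (`|kap (t - z.2.1, z.1 - z.2.2) * N z.2|)%:E.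
have mF : measurable_fun setT F.
  apply/measurable_EFinP; apply: measurableT_comp => //.
  exact: measurable_duhamel_integrand.
by apply: (@measurable_fun_fubini_tonelli_F _ _ _ _ R mu2 F mF) => z; rewrite lee_fin.
Qed.

(** Cauchy-Schwarz with weight q = |N| (t - s)^(-3/4): by Tonelli's theorem the
    squared L^2 norm is at most the product of the integral of q and that of
    |kap(t - s)|_2^2 (t - s)^(3/2) q, and the first factor is bounded by
    [weight_integral]. *)
Lemma duhamel_L2 (t w B : R) (N : R * R -> R) : (0 < w)%R -> (t <= T)%R -> (0 <= B)%R ->
  measurable_fun setT N ->
  (forall s y, ~~ (0 < s < t)%R -> N (s, y) = 0%R) ->
  (forall s, (0 < s < t)%R -> \int[mu]_y (`|N (s, y)|)%:E <= (B * expR (w ^+ 4 * s))%:E) ->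
  \int[mu]_x (duhamel t N x * duhamel t N x)
    <= (Dk * (B * (expR (w ^+ 4 * t) * (16 / w))) ^+ 2)%:E.
Proof.
move=> w0 tT B0 mN N0 NB.
set G := (expR (w ^+ 4 * t) * (16 / w))%R.
have G0 : (0 <= G)%R by rewrite mulr_ge0 ?expR_ge0// divr_ge0// ltW.
(* [q] is the weight of the Cauchy-Schwarz inequality and [p * q] the
   absolute value of the integrand *)
pose q (z : R * R) : R := (`|N z| * (t - z.1) `^ (- (3 / 4)))%R.
pose p (x : R) (z : R * R) : R := (`|kap (t - z.1, x - z.2)| * (t - z.1) `^ (3 / 4))%R.
have m1 : measurable_fun setT (fun z : R * R => t - z.1)%R.
  by apply: measurable_funB => //; exact: measurable_fst.
have mfst : measurable_fun setT (fun z : R * R => z.1) by exact: measurable_fst.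
have mq : measurable_fun setT q by rewrite /q; fmeas.
have mkx x : measurable_fun setT (fun z : R * R => kap (t - z.1, x - z.2)%R).
  apply: measurableT_comp => //; apply/measurable_fun_pair => //.
  by apply: measurable_funB => //; exact: measurable_snd.
have mp x : measurable_fun setT (p x).
  by have := mkx x => mk; rewrite /p; fmeas.
have q0 z : (0 <= q z)%R by rewrite mulr_ge0// powR_ge0.
have p0 x z : (0 <= p x z)%R by rewrite mulr_ge0// powR_ge0.
have pq x z : (p x z * q z = `|kap (t - z.1, x - z.2) * N z|)%R.
  case: z => s y; rewrite /p /q normrM /=.
  have [st|/N0 ->] := boolP (0 < s < t)%R; last by rewrite normr0 mul0r !mulr0.
  rewrite powRN -mulrA [X in (_ * X)%R]mulrCA mulfV ?mulr1//.
  by rewrite powR_eq0 negb_and subr_eq0; apply/orP; left; case/andP: st => _ /gt_eqF ->.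
have duhE x : duhamel t N x = \int[mu2]_z (p x z * q z)%:E.
  by apply: eq_integral => z _; rewrite pq.
have mqE : measurable_fun setT (EFin \o q) by exact/measurable_EFinP.
have Iq : \int[mu2]_z (q z)%:E <= (B * G)%:E.
  rewrite lebesgue2_tonelli//.
  have mN1 (s : R) : measurable_fun setT (fun y : R => N (s, y)).
    exact: (measurableT_comp mN (pair1_measurable s)).
  have inner (s : R) : \int[mu]_y (q (s, y))%:E =
      ((t - s) `^ (- (3 / 4)))%:E * \int[mu]_y (`|N (s, y)|)%:E.
    rewrite -ge0_integralZl//.
    - by apply: eq_integral => y _; rewrite /q/= EFinM muleC.
    - by apply/measurable_EFinP; apply: measurableT_comp => //; exact: mN1.
    - by rewrite lee_fin powR_ge0.
  pose W (s : R) : \bar R := ((t - s) `^ (- (3 / 4)) * expR (w ^+ 4 * s))%:E.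
  have mW : measurable_fun setT W.
    apply/measurable_EFinP.
    by change (measurable_fun setT (fun s : R => (t - s) `^ (- (3 / 4)) * expR (w ^+ 4 * s))%R); fmeas.
  apply: le_trans (_ : \int[mu]_(s in `]0%R, t[) (B%:E * W s) <= _).
    rewrite [leRHS]integral_mkcond; apply: ge0_le_integral => //.
    - by move=> s _; apply: integral_ge0 => y _; rewrite lee_fin.
    - by apply: (@measurable_fun_fubini_tonelli_F _ _ _ _ R mu (EFin \o q)) => // z; rewrite lee_fin.
    - apply/(measurable_restrictT _ _).1 => //.
      by apply: measurable_funTS; exact: measurable_funeM.
    - move=> s _; rewrite inner patchE; case: ifPn; rewrite ?notin_setE ?inE/= in_itv/= => st.
        rewrite /W !EFinM muleCA lee_wpmul2l ?lee_fin ?powR_ge0// -EFinM; exact: NB.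
      by rewrite integral0_eq ?mule0// => y _; rewrite N0 ?normr0//; exact/negP.
  rewrite ge0_integralZl//.
  - rewrite EFinM lee_wpmul2l// ?lee_fin//; exact: weight_integral.
  - exact: measurable_funTS.
  - by move=> s _; rewrite lee_fin mulr_ge0 ?powR_ge0 ?expR_ge0.
have mp2q : measurable_fun setT
    (fun z : R * (R * R) => (p z.1 z.2 ^+ 2 * q z.2)%:E).
  apply/measurable_EFinP; apply: measurable_funM; last exact: measurableT_comp.
  apply: measurable_funX; apply: measurable_funM.
    apply: measurableT_comp => //; apply: measurableT_comp => //.
    apply/measurable_fun_pair.
    - by apply: measurable_funB => //; apply: measurableT_comp => //.
    - by apply: measurable_funB => //; apply: measurableT_comp => //.
  by apply: fmeasurable_powR; apply: measurable_funB => //; apply: measurableT_comp.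
have p2q0 (z : R * (R * R)) : 0 <= (p z.1 z.2 ^+ 2 * q z.2)%:E.
  by rewrite lee_fin mulr_ge0// sqr_ge0.
have BG0 : (0 <= B * G)%R by rewrite mulr_ge0.
apply: le_trans (_ : \int[mu]_x ((B * G)%:E * \int[mu2]_z (p x z ^+ 2 * q z)%:E) <= _).
  apply: ge0_le_integral => //.
  - by move=> x _; apply: mule_ge0; apply: integral_ge0 => z _; rewrite lee_fin.
  - by apply: emeasurable_funM; exact: measurable_duhamel.
  - apply: measurable_funeM.
    exact: (@measurable_fun_fubini_tonelli_F _ _ _ _ R mu2
      (fun z : R * (R * R) => (p z.1 z.2 ^+ 2 * q z.2)%:E) mp2q p2q0).
  - move=> x _; rewrite duhE; have cs := cauchy_schwarz mu2 (mp x) mq (p0 x) q0. apply: (le_trans cs).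
    by rewrite muleC lee_wpmul2r//; apply: integral_ge0 => z _; exact: (p2q0 (x, z)).
rewrite ge0_integralZl//; last first.
- by move=> x _; apply: integral_ge0 => z _; exact: (p2q0 (x, z)).
- exact: (@measurable_fun_fubini_tonelli_F _ _ _ _ R mu2
      (fun z : R * (R * R) => (p z.1 z.2 ^+ 2 * q z.2)%:E) mp2q p2q0).
have -> : (Dk * (B * G) ^+ 2)%:E = (B * G)%:E * (Dk%:E * (B * G)%:E).
  by rewrite -!EFinM; congr EFin; ring.
rewrite lee_wpmul2l//.
rewrite (@fubini_tonelli _ _ _ _ R mu mu2
      (fun z : R * (R * R) => (p z.1 z.2 ^+ 2 * q z.2)%:E))//=.
apply: le_trans (_ : \int[mu2]_z (Dk%:E * (q z)%:E) <= _).
  apply: ge0_le_integral => //.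
  - by move=> z _; apply: integral_ge0 => x _; exact: (p2q0 (x, z)).
  - exact: (@measurable_fun_fubini_tonelli_G _ _ _ _ R mu
      (fun z : R * (R * R) => (p z.1 z.2 ^+ 2 * q z.2)%:E) mp2q p2q0).
  - exact: measurable_funeM.
  - move=> [s y] _.
    have [st|/N0 Nz] := boolP (0 < s < t)%R; last first.
      by rewrite /q Nz normr0 mul0r mule0; under eq_integral do rewrite mulr0; rewrite integral0.
    have [s0 st'] := andP st.
    have ts0 : (0 < t - s)%R by lra.
    pose k2 (x : R) : \bar R := (kap ((t - s)%R, x) ^+ 2)%:E.
    have mk2 : measurable_fun setT k2.
      apply/measurable_EFinP/measurable_funX.
      exact: (measurableT_comp mkap (pair1_measurable (t - s)%R)).
    have k20 x : 0 <= k2 x by rewrite lee_fin sqr_ge0.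
    have mk2y : measurable_fun setT (fun x : R => k2 (x - y)%R).
      apply: measurableT_comp => //.
      by have : measurable_fun setT (fun x : R => x - y)%R by fmeas.
    pose c := (((t - s) `^ (3 / 4)) ^+ 2 * q (s, y))%R.
    have c0 : 0 <= c%:E by rewrite lee_fin mulr_ge0// sqr_ge0.
    apply: le_trans (_ : \int[mu]_x (k2 (x - y)%R * c%:E) <= _).
      rewrite le_eqVlt; apply/orP; left; apply/eqP.
      apply: eq_integral => x _; rewrite /k2 /c /p/= -EFinM; congr EFin.
      rewrite exprMn (_ : `|_| ^+ 2 = kap (t - s, x - y)%R ^+ 2)%R; last by rewrite real_normK ?num_real.
      ring.
    rewrite ge0_integralZr// ge0_integral_shift//.
    apply: le_trans (lee_wpmul2r c0 (kapL2 ts0 _)) _; first by lra.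
    rewrite /c -!EFinM lee_fin mulrA ler_wpM2r// -mulrA ler_piMr//.
    rewrite -powR_mulrn ?powR_ge0// -powRrM -powRD; last by rewrite (gt_eqF ts0) implybT.
    by rewrite (_ : - (3 / 2) + 3 / 4 * 2 = 0)%R ?powRr0//; field.
rewrite ge0_integralZl//; last by move=> z _; rewrite lee_fin.
by rewrite lee_wpmul2l.
Qed.

End Duhamel.

(** * L2 norms and the kernel *)

Section AlmostEverywhere.
Context {R : realType}.
Local Notation mu := (@lebesgue_measure R).
Implicit Types P Q : R -> Prop.

Lemma ae_imp P Q : (forall x, P x -> Q x) ->
  {ae mu, forall x, P x} -> {ae mu, forall x, Q x}.
Proof. by move=> PQ; apply: (@filterS _ _ (ae_filter_ringOfSetsType mu)). Qed.

Lemma ae_and P Q : {ae mu, forall x, P x} -> {ae mu, forall x, Q x} ->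
  {ae mu, forall x, P x /\ Q x}.
Proof. by move=> hP hQ; apply: (@filterI _ _ (ae_filter_ringOfSetsType mu)). Qed.

End AlmostEverywhere.

Section L2Norm.
Context {R : realType}.
Local Notation mu := (@lebesgue_measure R).
Local Open Scope ereal_scope.

Lemma L2norm_sqr (f : R -> R) : L2norm f * L2norm f = \int[mu]_x (f x ^+ 2)%:E.
Proof. exact: Lnorm2_sqr. Qed.

Lemma L2norm_ge0 (f : R -> R) : 0 <= L2norm f.
Proof. exact: Lnorm_ge0. Qed.

Lemma le_of_sqr_le (x : \bar R) (K : R) : 0 <= x -> (0 <= K)%R ->
  x * x <= (K ^+ 2)%:E -> x <= K%:E.
Proof.
case: x => [r| |]//.
by rewrite -EFinM !lee_fin -expr2 => r0 K0; rewrite ler_sqr// ?nnegrE.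
Qed.

Lemma L2norm_le (f : R -> R) (K : R) : (0 <= K)%R ->
  \int[mu]_x (f x ^+ 2)%:E <= (K ^+ 2)%:E -> L2norm f <= K%:E.
Proof. by move=> K0; rewrite -L2norm_sqr; exact: le_of_sqr_le (L2norm_ge0 f) K0. Qed.

Lemma sqr_L2norm_le (f : R -> R) (K : R) : L2norm f <= K%:E ->
  \int[mu]_x (f x ^+ 2)%:E <= (K ^+ 2)%:E.
Proof.
move=> fK; rewrite -L2norm_sqr expr2 EFinM.
by apply: lee_pmul => //; exact: L2norm_ge0.
Qed.

Lemma inL2P (f : R -> R) : f \in L2 R <-> measurable_fun setT f /\ L2norm f < +oo.
Proof.
split; first by rewrite inE => /andP[]; rewrite !inE.
by move=> [mf ff]; rewrite inE; apply/andP; split; rewrite inE.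
Qed.

Lemma L2normD (f g : R -> R) : measurable_fun setT f -> measurable_fun setT g ->
  L2norm (fun x => f x + g x)%R <= L2norm f + L2norm g.
Proof. by move=> mf mg; apply: minkowski_EFin => //; rewrite ler1n. Qed.

Lemma L2normN (f : R -> R) : L2norm (fun x => - f x)%R = L2norm f.
Proof.
rewrite /L2norm -[RHS]oppe_Lnorm; congr Lnorm.
Qed.

Lemma L2normB (f g : R -> R) : measurable_fun setT f -> measurable_fun setT g ->
  L2norm (fun x => f x - g x)%R <= L2norm f + L2norm g.
Proof. by move=> mf mg; rewrite -(L2normN g); apply: L2normD => //; exact: measurable_funN. Qed.

Lemma L2norm_mul (f g : R -> R) : measurable_fun setT f -> measurable_fun setT g ->
  \int[mu]_x (`|f x * g x|)%:E <= L2norm f * L2norm g.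
Proof.
move=> mf mg; have h := @hoelder _ _ R mu f g 2 2 mf mg.
apply: le_trans (h _ _ _); rewrite ?ltr0n//; last by field.
by rewrite Lnorm1.
Qed.

Lemma L2norm_ae_le (f g : R -> R) : measurable_fun setT f -> measurable_fun setT g ->
  {ae mu, forall x, `|f x| <= g x}%R -> L2norm f <= L2norm g.
Proof.
move=> mf mg fg.
have [gy|] := eqVneq (L2norm g) +oo; first by rewrite gy leey.
rewrite -ltey => gfin.
have gf : L2norm g \is a fin_num by rewrite ge0_fin_numE ?L2norm_ge0.
rewrite -(fineK gf); apply: L2norm_le; first by rewrite fine_ge0 ?L2norm_ge0.
apply: le_trans (sqr_L2norm_le (_ : L2norm g <= (fine (L2norm g))%:E)); last by rewrite fineK.
apply: ae_ge0_le_integral => //.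
- by move=> x _; rewrite lee_fin sqr_ge0.
- by apply/measurable_EFinP/measurable_funX.
- by move=> x _; rewrite lee_fin sqr_ge0.
- by apply/measurable_EFinP/measurable_funX.
- apply: ae_imp fg => x h _; rewrite lee_fin -[(f x ^+ 2)%R]real_normK ?num_real//.
  by rewrite lerXn2r ?nnegrE// (le_trans _ h).
Qed.

End L2Norm.

Section KernelL2.
Context {R : realType}.
Local Notation mu := (@lebesgue_measure R).
Local Open Scope ereal_scope.

Lemma measurable_convolution (k f : R -> R) : measurable_fun setT k ->
  measurable_fun setT f -> measurable_fun setT (convolution k f).
Proof.
move=> mk mf.
pose F (p : R * R) : R := (k (p.1 - p.2) * f p.2)%R.
have mF : measurable_fun setT F by exact: measurable_sub_fun.
exact: (measurable_Rintegral_param (@measurableT _ R) mF).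
Qed.

(** A jointly measurable function of (t, x), defined for all t, which is the
    space derivative of the kernel for t > 0. *)
Definition kernel_dx (p : R * R) : R :=
  (- (4 * pi * osc_sin (@coef_a R) (@coef_b R) (sixth p.1) (2 * pi * p.2)))%R.

Lemma kernel_dxE (t x : R) : (0 < t)%R -> derive1 (Defs.kernel t) x = kernel_dx (t, x).
Proof. by move=> t0; rewrite (kernel_derive1 t0). Qed.

Lemma measurable_kernel_dx : measurable_fun setT kernel_dx.
Proof.
have m := @measurable_osc_sin R.
apply: measurable_funN; apply: measurable_funM => //.
Qed.

(** The squared L^2 norm of dK/dx is of order [freq t ^+ 3], that is
    t^(-3/2). *)
Lemma freq_cube (t : R) : (0 < t)%R -> (freq t ^+ 3 = t `^ (- (3 / 2)))%R.
Proof.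
move=> t0; rewrite /freq -exprVn -exprM powRN exprVn; congr (_^-1)%R.
by rewrite /sixth -powR_mulrn ?powR_ge0// -powRrM; congr powR; field.
Qed.

(** All that the proof uses of the kernel: the singularity of its derivative in
    L^2, its boundedness as a convolution operator on L^2, and the absolute
    convergence of the convolution integrals. *)
Definition kernel_L2_estimates (T C : R) : Prop :=
  forall t : R, (0 < t)%R -> (t <= T)%R ->
  [/\ \int[mu]_x (kernel_dx (t, x) ^+ 2)%:E <= (2 * C ^+ 2 * t `^ (- (3 / 2)))%:E,
      forall f, measurable_fun setT f ->
        L2norm (convolution (Defs.kernel t) f) <= (2 * C)%:E * L2norm f &
      L2norm (Defs.kernel t) < +oo].

Lemma ex_kernel_L2_estimates (T : R) : (0 < T)%R ->
  exists2 C : R, (0 < C)%R & kernel_L2_estimates T C.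
Proof.
move=> T0; have [C C0 HC] := kernel_bounds T0; exists C => // t t0 tT.
have w0 := freq_gt0 t0; set w := freq t in w0 *.
have HK x : (`|Defs.kernel t x| <= C * w * envelope w x)%R by have [] := HC t x t0 tT.
have cE := envelope_continuous w0.
have mE : measurable_fun setT (envelope w) by exact: continuous_measurable_fun.
have mK := kernel_measurable t0.
have E0 x : (0 <= envelope w x)%R := envelope_ge0 w x.
have E1 x : (envelope w x <= 1)%R.
  rewrite /envelope invf_le1.
    by rewrite expr_ge1// ?addr_ge0 ?lerDl// ?mulr_ge0// ltW.
  by rewrite exprn_gt0// ltr_pwDl// mulr_ge0// ltW.
have int_env (k : R) : (0 <= k)%R -> \int[mu]_x (k * envelope w x)%:E <= (k * (2 / w))%:E.
  move=> k0; under eq_integral do rewrite EFinM.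
  rewrite ge0_integralZl//; [|exact/measurable_EFinP|by move=> x _; rewrite lee_fin].
  by rewrite EFinM lee_wpmul2l// ?lee_fin//; exact: envelope_integral.
split.
- apply: le_trans (_ : \int[mu]_x ((C * w ^+ 2) ^+ 2 * envelope w x)%:E <= _).
    apply: ge0_le_integral => //.
    + by move=> x _; rewrite lee_fin sqr_ge0.
    + apply/measurable_EFinP/measurable_funX.
      exact: (measurableT_comp measurable_kernel_dx (pair1_measurable t)).
    + by apply/measurable_EFinP/measurable_funM.
    + move=> x _; rewrite lee_fin -(kernel_dxE x t0).
      have [_ h] := HC t x t0 tT.
      move: (derive1 (Defs.kernel t) x : R) h => k h.
      rewrite -[(k ^+ 2)%R]real_normK ?num_real// /envelope -exprVn -exprMn.
      by rewrite lerXn2r ?nnegrE// (le_trans _ h).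
  apply: le_trans (int_env _ _) _; first exact: sqr_ge0.
  rewrite lee_fin -freq_cube// -/w le_eqVlt; apply/orP; left; apply/eqP.
  by field; rewrite gt_eqF.
- move=> f mf.
  have [fy|] := eqVneq (L2norm f) +oo.
    by rewrite fy gt0_muley ?leey// lte_fin mulr_gt0.
  rewrite -ltey => ffin.
  have ff : L2norm f \is a fin_num by rewrite ge0_fin_numE ?L2norm_ge0.
  pose E x : R := (C * w * envelope w x)%R.
  have Ex0 x : (0 <= E x)%R by rewrite /E !mulr_ge0 ?(ltW C0) ?(ltW w0).
  have mEx : measurable_fun setT E by exact: measurable_funM.
  have EA : \int[mu]_x (E x)%:E <= (2 * C)%:E.
    apply: le_trans (int_env _ _) _; first by rewrite mulr_ge0 ?ltW.
    rewrite lee_fin le_eqVlt; apply/orP; left; apply/eqP.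
    by field; rewrite gt_eqF.
  have mnf : measurable_fun setT (fun y => `|f y|)%R by exact: measurableT_comp.
  have := young mEx Ex0 EA mnf (fun y => normr_ge0 (f y)).
  under [X in _ <= _ * (_ * X) -> _]eq_integral do rewrite real_normK ?num_real//.
  rewrite -L2norm_sqr -(fineK ff) -!EFinM => h.
  apply: L2norm_le; first by rewrite !mulr_ge0 ?(ltW C0) ?fine_ge0 ?L2norm_ge0.
  rewrite (_ : (_ ^+ 2)%R = (2 * C * (2 * C * (fine (L2norm f) * fine (L2norm f))))%R);
    last by ring.
  have mKf : measurable_fun setT (fun p : R * R => Defs.kernel t (p.1 - p.2) * f p.2)%R.
    exact: measurable_sub_fun.
  apply: le_trans h; apply: ge0_le_integral => //.
  + by move=> x _; rewrite lee_fin sqr_ge0.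
  + apply/measurable_EFinP/measurable_funX.
    exact: measurable_convolution.
  + have mJ : measurable_fun setT (fun x : R => \int[mu]_y (`|f y| * E (x - y))%:E).
      apply: (@measurable_fun_fubini_tonelli_F _ _ _ _ R mu
        (fun p : R * R => (`|f p.2| * E (p.1 - p.2))%:E)) => [|p]; last first.
        by rewrite lee_fin mulr_ge0.
      apply/measurable_EFinP; under eq_fun do rewrite mulrC.
      exact: (@measurable_sub_fun R E (fun y => `|f y|)%R).
    exact: emeasurable_funM.
  + move=> x _; rewrite -real_normK ?num_real// expr2 EFinM.
    have le1 : (`|convolution (Defs.kernel t) f x|)%:E <= \int[mu]_y (`|f y| * E (x - y))%:E.
      have mKx : measurable_fun setT (fun y : R => Defs.kernel t (x - y) * f y)%R.
        exact: (measurableT_comp mKf (pair1_measurable x)).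
      apply: (le_trans (abs_Rintegral_le mu measurableT mKx)).
      apply: ge0_le_integral => //.
      * by apply/measurable_EFinP; exact: measurableT_comp.
      * apply/measurable_EFinP; apply: measurable_funM => //.
        apply: measurableT_comp => //.
        by have : measurable_fun setT (fun y : R => x - y)%R by fmeas.
      * by move=> y _; rewrite lee_fin normrM mulrC ler_wpM2l.
    by apply: lee_pmul.
- apply: le_lt_trans (_ : _ <= (C * w * (1 + 2 / w))%:E) _; last by rewrite ltry.
  have k0 : (0 <= C * w)%R by rewrite mulr_ge0 ?ltW.
  have w2 : (0 <= 2 / w)%R by rewrite divr_ge0// ltW.
  apply: L2norm_le; first by rewrite mulr_ge0// addr_ge0.
  apply: le_trans (_ : \int[mu]_x ((C * w) ^+ 2 * envelope w x)%:E <= _).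
    apply: ge0_le_integral => //.
    + by move=> x _; rewrite lee_fin sqr_ge0.
    + by apply/measurable_EFinP/measurable_funX.
    + by apply/measurable_EFinP/measurable_funM.
    + move=> x _; rewrite lee_fin -real_normK ?num_real//.
      apply: le_trans (_ : (C * w * envelope w x) ^+ 2 <= _)%R.
        by rewrite lerXn2r ?nnegrE// (le_trans _ (HK x)).
      by rewrite exprMn ler_wpM2l ?sqr_ge0// expr2 ler_piMr.
  apply: le_trans (int_env _ _) _; first exact: sqr_ge0.
  rewrite lee_fin [leRHS]exprMn ler_wpM2l ?sqr_ge0//.
  by move: (2 / w)%R w2 => z z0; rewrite expr2; nra.
Qed.

End KernelL2.

(** * The difference of two mild solutions *)

Section Differences.
Context {R : realType}.
Local Notation mu := (@lebesgue_measure R).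
Local Notation mu2 := (@lebesgue2 R).
Local Open Scope ereal_scope.

Lemma convolution_integrable (k f : R -> R) (x : R) :
  measurable_fun setT k -> L2norm k < +oo -> f \in L2 R ->
  mu.-integrable setT (fun y => (k (x - y) * f y)%:E).
Proof.
move=> mk kfin /inL2P[mf ffin].
have kf : L2norm k \is a fin_num by rewrite ge0_fin_numE ?L2norm_ge0.
have ff : L2norm f \is a fin_num by rewrite ge0_fin_numE ?L2norm_ge0.
have mkx : measurable_fun setT (fun y : R => k (x - y))%R.
  apply: measurableT_comp => //.
  by have : measurable_fun setT (fun y : R => x - y)%R by fmeas.
have kx : L2norm (fun y => k (x - y))%R <= (fine (L2norm k))%:E.
  apply: L2norm_le; first by rewrite fine_ge0 ?L2norm_ge0.
  pose k2 (y : R) : \bar R := (k y ^+ 2)%:E.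
  have mk2 : measurable_fun setT k2 by apply/measurable_EFinP/measurable_funX.
  have k20 y : 0 <= k2 y by rewrite lee_fin sqr_ge0.
  apply: le_trans (_ : \int[mu]_y k2 (x - y)%R <= _) => //.
  by rewrite ge0_integral_reflect//; apply: sqr_L2norm_le; rewrite fineK.
apply/integrableP; split; first by apply/measurable_EFinP/measurable_funM.
apply: le_lt_trans (L2norm_mul mkx mf) _.
apply: le_lt_trans (_ : _ <= (fine (L2norm k))%:E * (fine (L2norm f))%:E) _.
  by apply: lee_pmul => //; rewrite ?L2norm_ge0// fineK.
by rewrite -EFinM ltry.
Qed.

Lemma convolutionB (k f g : R -> R) (x : R) :
  measurable_fun setT k -> L2norm k < +oo -> f \in L2 R -> g \in L2 R ->
  (convolution k f x - convolution k g x = convolution k (fun y => f y - g y) x)%R.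
Proof.
move=> mk kfin fL gL.
rewrite /convolution -RintegralB//; last 2 first.
- exact: convolution_integrable.
- exact: convolution_integrable.
by apply: eq_Rintegral => y _; rewrite mulrBr.
Qed.

(** Fubini's theorem; the inner real-valued integral differs from the extended
    one only on a negligible set of [s]. *)
Lemma Rintegral_lebesgue2 (F : R * R -> R) : mu2.-integrable setT (EFin \o F) ->
  (\int[mu]_s (\int[mu]_y F (s, y)) = \int[mu2]_q F q)%R.
Proof.
move=> iF.
have mF : measurable_fun setT F by apply/measurable_EFinP; exact: measurable_int iF.
have aeI : {ae mu, forall s : R, mu.-integrable setT (fun y => (F (s, y))%:E)}.
  exact: (@ae_integrable1 _ _ _ _ R mu mu (EFin \o F) iF).
rewrite /Rintegral -(@integral12_prod_meas1 _ _ _ _ R mu mu (EFin \o F) iF).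
congr fine; apply: ae_eq_integral => //.
- apply/measurable_EFinP.
  exact: (measurable_Rintegral_param (@measurableT _ R) mF).
- exact: (@measurable_fubini_F _ _ _ _ R mu mu (EFin \o F) iF).
- apply: ae_imp aeI => s is' _.
  by rewrite fineK//; exact: integrable_fin_num.
Qed.

Lemma duhamel_integrable (t x : R) (N : R * R -> R) : measurable_fun setT N ->
  duhamel kernel_dx t N x < +oo ->
  mu2.-integrable setT (EFin \o (fun q => kernel_dx (t - q.1, x - q.2) * N q)%R).
Proof.
move=> mN fin; apply/integrableP; split => //.
apply/measurable_EFinP.
exact: (measurableT_comp (measurable_duhamel_integrand measurable_kernel_dx t mN)
  (pair1_measurable x)).
Qed.

(** Under absolute convergence the iterated integral of the mild formulation is
    an integral over the plane; the source vanishes outside ]0, t[, which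
    removes the restriction on [s]. *)
Lemma duhamel_term (t x : R) (f : R -> R -> R) (N : R * R -> R) :
  measurable_fun setT N ->
  (forall s y, ~~ (0 < s < t)%R -> N (s, y) = 0%R) ->
  (forall s y, (0 < s < t)%R -> N (s, y) = f s y) ->
  duhamel kernel_dx t N x < +oo ->
  (\int[mu]_(s in `]0, t[) convolution (derive1 (Defs.kernel (t - s))) (f s) x =
   \int[mu2]_q (kernel_dx (t - q.1, x - q.2) * N q))%R.
Proof.
move=> mN N0 Nf fin.
rewrite -Rintegral_lebesgue2; last exact: duhamel_integrable.
rewrite Rintegral_mkcond; apply: eq_Rintegral => s _.
rewrite patchE; case: ifPn; rewrite ?notin_setE ?inE/= in_itv/= => st.
  have ts : (0 < t - s)%R by case/andP: st => _ ?; lra.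
  by apply: eq_Rintegral => y _; rewrite kernel_dxE// Nf.
rewrite /Rintegral integral0_eq// => y _.
by rewrite N0 ?mulr0//; exact/negP.
Qed.

(** A function with finite L^2 norm is finite almost everywhere: this is where
    the absolute convergence of the time integral comes from. *)
Lemma duhamel_lty (T t w B : R) (N : R * R -> R) :
  (0 < T)%R -> (0 < w)%R -> (t <= T)%R -> (0 <= B)%R ->
  measurable_fun setT N ->
  (forall s y, ~~ (0 < s < t)%R -> N (s, y) = 0%R) ->
  (forall s, (0 < s < t)%R -> \int[mu]_y (`|N (s, y)|)%:E <= (B * expR (w ^+ 4 * s))%:E) ->
  {ae mu, forall x : R, duhamel kernel_dx t N x < +oo}.
Proof.
move=> T0 w0 tT B0 mN N0 NB.
have [C C0 HC] := ex_kernel_L2_estimates T0.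
have bnd s : (0 < s)%R -> (s <= T)%R ->
    \int[mu]_x (kernel_dx (s, x) ^+ 2)%:E <= (2 * C ^+ 2 * s `^ (- (3 / 2)))%:E.
  by move=> s0 sT; have [] := HC s s0 sT.
have D0 : (0 <= 2 * C ^+ 2)%R by rewrite mulr_ge0// sqr_ge0.
have h := duhamel_L2 measurable_kernel_dx bnd D0 w0 tT B0 mN N0 NB.
have mJ := measurable_duhamel measurable_kernel_dx t mN.
have J0 x : 0 <= duhamel kernel_dx t N x by apply: integral_ge0 => q _; rewrite lee_fin.
have iJ : mu.-integrable setT (fun x => duhamel kernel_dx t N x * duhamel kernel_dx t N x).
  apply/integrableP; split; first exact: emeasurable_funM.
  apply: le_lt_trans (_ : _ <= (2 * C ^+ 2 * (B * (expR (w ^+ 4 * t) * (16 / w))) ^+ 2)%:E) _;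
    last exact: ltry.
  apply: le_trans h; rewrite le_eqVlt; apply/orP; left; apply/eqP.
  by apply: eq_integral => x _; rewrite gee0_abs// mule_ge0.
have := integrable_ae measurableT iJ.
apply: ae_imp => x /(_ I) hx; rewrite ltey; apply/eqP => Jy.
by move: hx; rewrite Jy mulyy.
Qed.

End Differences.

Section MildDifference.
Context {R : realType}.
Local Notation mu := (@lebesgue_measure R).
Local Notation mu2 := (@lebesgue2 R).
Local Open Scope ereal_scope.

(** The source u^2, cut off to times in ]0, t[: joint measurability is only
    known there, and the Duhamel integral sees nothing else. *)
Definition square_before (t : R) (u : R -> R -> R) (p : R * R) : R :=
  ((((fun q => u q.1 q.2) \_ (`]0%R, t[%classic `*` [set: R])) p) ^+ 2)%R.

Lemma square_before0 (t : R) (u : R -> R -> R) (s y : R) :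
  ~~ (0 < s < t)%R -> square_before t u (s, y) = 0%R.
Proof.
move=> st; rewrite /square_before patchE; case: ifPn; last by rewrite expr0n.
by rewrite inE/= in_itv/= => -[h _]; rewrite h in st.
Qed.

Lemma square_beforeE (t : R) (u : R -> R -> R) (s y : R) :
  (0 < s < t)%R -> square_before t u (s, y) = (u s y ^+ 2)%R.
Proof.
by move=> st; rewrite /square_before patchE mem_set// /=; split => //; rewrite in_itv.
Qed.

Lemma measurable_square_before (T t : R) (u : R -> R -> R) : (t <= T)%R ->
  measurable_fun (`]0%R, T[%classic `*` [set: R]) (fun p : R * R => u p.1 p.2) ->
  measurable_fun setT (square_before t u).
Proof.
move=> tT mu'; apply: measurable_funX.
have mD : measurable (`]0%R, t[%classic `*` [set: R]) by apply: measurableX.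
apply/(measurable_restrictT _ _).1 => //; apply: measurable_funS mu'.
  by apply: measurableX.
by move=> [s y] /= [+ _]; rewrite !in_itv/= => /andP[s0 st]; split => //; rewrite s0 (lt_le_trans st).
Qed.

Lemma sqr_fine_le (x : \bar R) : 0 <= x -> (fine x ^+ 2)%:E <= x * x.
Proof. by case: x => [r| |]//= _; rewrite ?expr0n ?mulyy ?leey// -EFinM -expr2. Qed.

(** One step of the Gronwall argument, at a time where both mild formulations
    hold: an a priori bound Th e^(w^4 s) on the difference is turned into a
    bound with a factor 1 / w. *)
Lemma mild_difference_L2 (T C M w Th t : R) (u0 v0 : R -> R) (u v : R -> R -> R) :
  kernel_L2_estimates T C ->
  (0 < C)%R -> (0 <= M)%R -> (0 < w)%R -> (0 <= Th)%R -> (0 < t < T)%R ->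
  u0 \in L2 R -> v0 \in L2 R ->
  measurable_fun (`]0%R, T[%classic `*` [set: R]) (fun p : R * R => u p.1 p.2) ->
  measurable_fun (`]0%R, T[%classic `*` [set: R]) (fun p : R * R => v p.1 p.2) ->
  (forall s : R, (0 < s < T)%R -> measurable_fun setT (u s) /\ L2norm (u s) <= M%:E) ->
  (forall s : R, (0 < s < T)%R -> measurable_fun setT (v s) /\ L2norm (v s) <= M%:E) ->
  (forall s : R, (0 < s < T)%R ->
     L2norm (fun x => u s x - v s x)%R <= (Th * expR (w ^+ 4 * s))%:E) ->
  {ae mu, forall x, u t x = (convolution (Defs.kernel t) u0 x
        - 1 / 2 * \int[mu]_(s in `]0%R, t[)
            convolution (derive1 (Defs.kernel (t - s))) (fun y => u s y ^+ 2) x)%R} ->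
  {ae mu, forall x, v t x = (convolution (Defs.kernel t) v0 x
        - 1 / 2 * \int[mu]_(s in `]0%R, t[)
            convolution (derive1 (Defs.kernel (t - s))) (fun y => v s y ^+ 2) x)%R} ->
  L2norm (fun x => u t x - v t x)%R <=
    (2 * C)%:E * L2norm (fun x => u0 x - v0 x)%R
    + (2 * C * M * Th * (expR (w ^+ 4 * t) * (16 / w)))%:E.
Proof.
move=> HC C0 M0 w0 Th0 /andP[t0 tT] u0L v0L mu' mv' uM vM uvTh equ eqv.
have T0 : (0 < T)%R by exact: lt_trans tT.
have stT s : (0 < s < t)%R -> (0 < s < T)%R by move=> /andP[-> h]; rewrite (lt_trans h).
have mNu := measurable_square_before (ltW tT) mu'.
have mNv := measurable_square_before (ltW tT) mv'.
pose N p := (square_before t u p - square_before t v p)%R.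
have mN : measurable_fun setT N by exact: measurable_funB.
have N0 s y : ~~ (0 < s < t)%R -> N (s, y) = 0%R.
  by move=> st; rewrite /N !square_before0// subr0.
have sqB (f : R -> R -> R) : (forall s : R, (0 < s < T)%R -> measurable_fun setT (f s) /\ L2norm (f s) <= M%:E) ->
    forall s, (0 < s < t)%R ->
    \int[mu]_y (`|square_before t f (s, y)|)%:E <= (M ^+ 2 * expR (1 ^+ 4 * s))%:E.
  move=> fM s st; have [_ fMs] := fM s (stT _ st).
  apply: le_trans (_ : _ <= (M ^+ 2)%:E) _; last first.
    rewrite lee_fin ler_peMr ?sqr_ge0// expr1n mul1r.
    have := expR_ge1Dx s; case/andP: st => s0 _; lra.
  apply: le_trans (sqr_L2norm_le fMs); rewrite le_eqVlt; apply/orP; left; apply/eqP.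
  by apply: eq_integral => y _; rewrite square_beforeE// ger0_norm ?sqr_ge0.
have NB s : (0 < s < t)%R ->
    \int[mu]_y (`|N (s, y)|)%:E <= (2 * M * Th * expR (w ^+ 4 * s))%:E.
  move=> st; have [mus uMs] := uM s (stT _ st); have [mvs vMs] := vM s (stT _ st).
  apply: le_trans (_ : \int[mu]_y (`|(u s y - v s y) * (u s y + v s y)|)%:E <= _).
    rewrite le_eqVlt; apply/orP; left; apply/eqP.
    by apply: eq_integral => y _; rewrite /N !square_beforeE// subr_sqr.
  apply: le_trans (L2norm_mul (measurable_funB mus mvs) (measurable_funD mus mvs)) _.
  have -> : (2 * M * Th * expR (w ^+ 4 * s))%:E = (Th * expR (w ^+ 4 * s))%:E * (M + M)%:E.
    by rewrite -EFinM; congr EFin; ring.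
  apply: lee_pmul; rewrite ?L2norm_ge0//; first exact/uvTh/stT.
  by apply: le_trans (L2normD mus mvs) _; rewrite EFinD leeD.
have kapB s : (0 < s)%R -> (s <= T)%R -> \int[mu]_x (kernel_dx (s, x) ^+ 2)%:E <= (2 * C ^+ 2 * s `^ (- (3 / 2)))%:E.
  by move=> s0 sT; have [] := HC s s0 sT.
have D0 : (0 <= 2 * C ^+ 2)%R by rewrite mulr_ge0// sqr_ge0.
have B0 : (0 <= 2 * M * Th)%R by rewrite !mulr_ge0.
(* for u^2 and v^2 separately only the convergence matters, so the weight is 1 *)
have finu := duhamel_lty T0 ltr01 (ltW tT) (sqr_ge0 M) mNu (square_before0 u) (sqB u uM).
have finv := duhamel_lty T0 ltr01 (ltW tT) (sqr_ge0 M) mNv (square_before0 v) (sqB v vM).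
have finN := duhamel_lty T0 w0 (ltW tT) B0 mN N0 NB.
have JL2 := duhamel_L2 measurable_kernel_dx kapB D0 w0 (ltW tT) B0 mN N0 NB.
have mJ := measurable_duhamel measurable_kernel_dx t mN.
have J0 x : 0 <= duhamel kernel_dx t N x by apply: integral_ge0 => q _; rewrite lee_fin.
pose j x : R := (2^-1 * fine (duhamel kernel_dx t N x))%R.
have mj : measurable_fun setT j.
  by apply: measurable_funM => //; apply: measurableT_comp.
have [_ cvL2 Kfin] := HC t t0 (ltW tT).
have mK := kernel_measurable t0.
pose d0 x := (u0 x - v0 x)%R.
have /inL2P[mu0 _] := u0L; have /inL2P[mv0 _] := v0L.
have md0 : measurable_fun setT d0 by exact: measurable_funB.
have mc : measurable_fun setT (convolution (Defs.kernel t) d0) by exact: measurable_convolution.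
have mcn : measurable_fun setT (fun x => `|convolution (Defs.kernel t) d0 x|)%R.
  exact: measurableT_comp.
have ttT : (0 < t < T)%R by rewrite t0.
have [mut _] := uM t ttT; have [mvt _] := vM t ttT.
set G := (expR (w ^+ 4 * t) * (16 / w))%R.
have G0 : (0 <= G)%R by rewrite mulr_ge0 ?expR_ge0// divr_ge0// ltW.
have CM0 : (0 <= 2 * C * M * Th)%R by rewrite !mulr_ge0 ?(ltW C0).
have jL2 : L2norm j <= (2 * C * M * Th * G)%:E.
  apply: L2norm_le; first exact: mulr_ge0.
  apply: le_trans (_ : \int[mu]_x ((4^-1)%:E * (duhamel kernel_dx t N x * duhamel kernel_dx t N x)) <= _).
    apply: ge0_le_integral => //.
    - by move=> x _; rewrite lee_fin sqr_ge0.
    - by apply/measurable_EFinP/measurable_funX.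
    - by apply: measurable_funeM; exact: emeasurable_funM.
    - move=> x _; rewrite /j exprMn (_ : 2^-1 ^+ 2 = 4^-1)%R; last by field.
      by rewrite EFinM lee_wpmul2l ?lee_fin ?invr_ge0// sqr_fine_le.
  rewrite ge0_integralZl//; last 2 first.
  - exact: emeasurable_funM.
  - by move=> x _; exact: mule_ge0.
  apply: le_trans (lee_wpmul2l _ JL2) _; first by rewrite lee_fin invr_ge0.
  rewrite -/G -EFinM lee_fin.
  have -> : (4^-1 * (2 * C ^+ 2 * (2 * M * Th * G) ^+ 2) = 2 * (C * M * Th * G) ^+ 2)%R by field.
  have -> : ((2 * C * M * Th * G) ^+ 2 = 4 * (C * M * Th * G) ^+ 2)%R by ring.
  by rewrite ler_wpM2r ?sqr_ge0//; lra.
have pointwise : {ae mu, forall x, `|u t x - v t x| <= `|convolution (Defs.kernel t) d0 x| + j x}%R.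
  have := ae_and (ae_and equ eqv) (ae_and finN (ae_and finu finv)).
  apply: ae_imp => x [[-> ->] [fN [fu fv]]].
  have tu := duhamel_term mNu (square_before0 u)
    (fun s y => @square_beforeE t u s y) fu.
  have tv := duhamel_term mNv (square_before0 v)
    (fun s y => @square_beforeE t v s y) fv.
  rewrite tu tv.
  have iu := duhamel_integrable mNu fu; have iv := duhamel_integrable mNv fv.
  have -> (a b c d : R) : (a - 1 / 2 * b - (c - 1 / 2 * d) = (a - c) - 2^-1 * (b - d))%R by field.
  rewrite convolutionB// -RintegralB//.
  apply: le_trans (ler_normB _ _) _; rewrite lerD2l normrM ger0_norm ?invr_ge0// /j.
  rewrite ler_wpM2l ?invr_ge0// -lee_fin fineK ?ge0_fin_numE//.
  have iN := duhamel_integrable mN fN.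
  have -> : (\int[mu2]_q (kernel_dx (t - q.1, x - q.2) * square_before t u q
      - kernel_dx (t - q.1, x - q.2) * square_before t v q) =
      \int[mu2]_q (kernel_dx (t - q.1, x - q.2) * N q))%R.
    by apply: eq_Rintegral => q _; rewrite /N mulrBr.
  apply: abs_Rintegral_le => //.
  by apply/measurable_EFinP; exact: measurable_int iN.
have h1 := L2norm_ae_le (measurable_funB mut mvt) (measurable_funD mcn mj) pointwise.
apply: le_trans h1 _; apply: le_trans (L2normD mcn mj) _; apply: leeD => //.
apply: le_trans (cvL2 _ md0); rewrite /L2norm.
by rewrite -[leRHS]Lnorm_abse.
Qed.

End MildDifference.

(** * The Gronwall argument *)

Section Bootstrapping.
Context {R : realType}.
Local Notation mu := (@lebesgue_measure R).

(** A set of full measure meets every nondegenerate interval. *)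
Lemma ae_meets_within (P A : R -> Prop) (T t : R) : 0 < T -> t \in `[0, T] ->
  {ae mu, forall s : R, P s} ->
  (\forall s \near within `[0, T] (nbhs t), A s) ->
  exists s : R, [/\ 0 < s, s < T, P s & A s].
Proof.
rewrite in_itv/= => T0 /andP[t0 tT] aeP nA.
have /nbhs_ballP[r/= r0 rA] : nbhs t [set s | `[0, T]%classic s -> A s] by exact: nA.
apply/not_existsP => noS.
pose l := Num.max 0 (t - r); pose h := Num.min T (t + r).
have lh : l < h.
  by rewrite /l /h lt_min !gt_max T0 /=; apply/and3P; split; lra.
have sub : `]l, h[%classic `<=` ~` [set s | P s].
  move=> s /=; rewrite in_itv/= /l /h gt_max lt_min => /andP[/andP[s0 s1] /andP[s2 s3]] Ps.
  apply: (noS s); split => //; apply: rA => /=; last by rewrite in_itv/= !ltW.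
  by rewrite /ball/= ltr_distlC; apply/andP; split; lra.
have [N [mN N0 PN]] := aeP.
have : (mu `]l, h[%classic <= mu N)%E.
  by apply: le_measure; rewrite ?inE//; exact: subset_trans sub PN.
by rewrite N0 lebesgue_measure_itv/= lte_fin lh -EFinB lee_fin subr_le0 leNgt lh.
Qed.

(** An almost everywhere inequality between a lower semicontinuous function and
    a continuous one holds at every point, in particular at 0 and T, where the
    mild formulation gives nothing. *)
Lemma ae_le_everywhere (T : R) (D : R -> \bar R) (b : R -> R) : 0 < T ->
  (forall t e : R, t \in `[0, T] -> 0 < e ->
     \forall s \near within `[0, T] (nbhs t), (D t <= D s + e%:E)%E) ->
  continuous b ->
  {ae mu, forall s : R, s \in `]0, T[ -> (D s <= (b s)%:E)%E} ->
  forall t : R, t \in `[0, T] -> (D t <= (b t)%:E)%E.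
Proof.
move=> T0 Dlsc cb aeD t tT; apply/lee_addgt0Pr => e e0.
have e2 : 0 < e / 2 by rewrite divr_gt0.
have nb : \forall s \near within `[0, T] (nbhs t), b s <= b t + e / 2.
  have : \forall s \near nbhs t, `|b t - b s| < e / 2.
    by have /cvgrPdist_lt/(_ _ e2) := cb t.
  apply: filterS => s h _; move: h; rewrite ltr_distlC => /andP[_ h]; lra.
have [s [s0 sT Ds [h1 h2]]] := ae_meets_within T0 tT aeD (filterI (Dlsc t (e / 2) tT e2) nb).
have {}Ds : (D s <= (b s)%:E)%E by apply: Ds; rewrite in_itv/= s0.
apply: (le_trans h1); apply: le_trans (leeD2r _ Ds) _.
by rewrite -!EFinD lee_fin; lra.
Qed.

Lemma C_L2_near (T : R) (w : R -> R -> R) (t e : R) : C_L2 T w -> t \in `[0, T] -> 0 < e ->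
  \forall s \near within `[0, T] (nbhs t), (L2norm (w s \- w t)%R <= e%:E)%E.
Proof.
move=> [_ cw] tT e0; have := cw t tT.
move=> /fine_cvgP[nfin /cvgrPdist_lt/(_ e e0) hlt].
near=> s.
have fin : L2norm (w s \- w t)%R \is a fin_num by near: s.
have : `|0 - fine (L2norm (w s \- w t)%R)| < e by near: s.
rewrite sub0r normrN => h; rewrite -(fineK fin) lee_fin.
exact: ltW (le_lt_trans (ler_norm _) h).
Unshelve. all: end_near. Qed.

Lemma within_mem (T t : R) : \forall s \near within `[0, T] (nbhs t), s \in `[0, T].
Proof. by apply: withinT; exact: nbhs_filter. Qed.

Lemma C_L2_measurable (T : R) (w : R -> R -> R) (t : R) : C_L2 T w -> t \in `[0, T] ->
  measurable_fun setT (w t).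
Proof. by move=> [wL _] tT; have /inL2P[] := wL t tT. Qed.

(** The essential supremum of a continuous function is its supremum; in
    particular the norm in C([0, T]; L^2) is finite. *)
Lemma C_L2_bound (T B : R) (w : R -> R -> R) : 0 < T -> C_L2 T w ->
  {ae mu, forall t : R, t \in `]0, T[ -> (L2norm (w t) <= B%:E)%E} ->
  forall t : R, t \in `[0, T] -> (L2norm (w t) <= B%:E)%E.
Proof.
move=> T0 cw; apply: (@ae_le_everywhere T (fun t => L2norm (w t)) (fun=> B)) => //; last first.
  by move=> t; exact: cvg_cst.
move=> t e tT e0; have mt := C_L2_measurable cw tT.
near=> s.
have sT : s \in `[0, T] by near: s; exact: within_mem.
have h : (L2norm (w s \- w t)%R <= e%:E)%E by near: s; exact: C_L2_near.
have ms := C_L2_measurable cw sT.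
have -> : L2norm (w t) = L2norm (fun x => w s x - (w s \- w t) x).
  by congr (L2norm _); apply/funext => x /=; ring.
by apply: le_trans (L2normB ms (measurable_funB ms mt)) _; exact: leeD2l.
Unshelve. all: end_near. Qed.

Lemma C_L2_difference_lsc (T : R) (u v : R -> R -> R) (t e : R) : C_L2 T u -> C_L2 T v ->
  t \in `[0, T] -> 0 < e ->
  \forall s \near within `[0, T] (nbhs t),
    (L2norm (fun x => u t x - v t x)%R <= L2norm (fun x => u s x - v s x)%R + e%:E)%E.
Proof.
move=> cu cv tT e0; have e2 : 0 < e / 2 by rewrite divr_gt0.
have mut := C_L2_measurable cu tT; have mvt := C_L2_measurable cv tT.
near=> s.
have sT : s \in `[0, T] by near: s; exact: within_mem.
have hu : (L2norm (u s \- u t)%R <= (e / 2)%:E)%E by near: s; exact: C_L2_near.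
have hv : (L2norm (v s \- v t)%R <= (e / 2)%:E)%E by near: s; exact: C_L2_near.
have mus := C_L2_measurable cu sT; have mvs := C_L2_measurable cv sT.
have -> : L2norm (fun x => u t x - v t x)%R =
    L2norm (fun x => (u s x - v s x) - ((u s \- u t) x - (v s \- v t) x))%R.
  by congr (L2norm _); apply/funext => x /=; ring.
apply: le_trans (L2normB (measurable_funB mus mvs)
  (measurable_funB (measurable_funB mus mut) (measurable_funB mvs mvt))) _.
rewrite leeD2l//.
apply: le_trans (L2normB (measurable_funB mus mut) (measurable_funB mvs mvt)) _.
by rewrite [e]splitr EFinD; exact: leeD.
Unshelve. all: end_near. Qed.

(** The Gronwall argument.  The constant w = 64 C M + 1 is such that one step
    ([mild_difference_L2]) halves the a priori bound:
    2 C M * 16 / w <= 1 / 2. *)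
Lemma stability (T C M : R) (u0 v0 : R -> R) (u v : R -> R -> R) :
  0 < T -> 0 < C -> 0 <= M ->
  kernel_L2_estimates T C ->
  u0 \in L2 R -> v0 \in L2 R ->
  mild_solution T u0 u -> C_L2 T u -> mild_solution T v0 v -> C_L2 T v ->
  (forall t, t \in `[0, T] -> (L2norm (u t) <= M%:E)%E) ->
  (forall t, t \in `[0, T] -> (L2norm (v t) <= M%:E)%E) ->
  forall t, t \in `[0, T] ->
  (L2norm (fun x => u t x - v t x)%R <=
   (4 * C * expR ((64 * C * M + 1) ^+ 4 * T))%:E * L2norm (fun x => u0 x - v0 x)%R)%E.
Proof.
move=> T0 C0 M0 HC u0L v0L [[mu' _] equ] cu [[mv' _] eqv] cv uM vM.
pose D t := L2norm (fun x => u t x - v t x)%R.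
pose d0 := fine (L2norm (fun x => u0 x - v0 x)%R).
have d0E : L2norm (fun x => u0 x - v0 x)%R = d0%:E.
  rewrite fineK// ge0_fin_numE ?L2norm_ge0//.
  have /inL2P[mu0 fu0] := u0L; have /inL2P[mv0 fv0] := v0L.
  by apply: le_lt_trans (L2normB mu0 mv0) _; rewrite lte_add_pinfty.
have d00 : 0 <= d0 by rewrite fine_ge0 ?L2norm_ge0.
pose w := 64 * C * M + 1.
have w0 : 0 < w by rewrite /w ltr_wpDl// !mulr_ge0// ltW.
have DM t : t \in `[0, T] -> (D t <= (2 * M)%:E)%E.
  move=> tT; apply: le_trans (L2normB (C_L2_measurable cu tT) (C_L2_measurable cv tT)) _.
  by rewrite (_ : 2 * M = M + M) ?EFinD ?leeD ?uM ?vM//; ring.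
have DE t : t \in `[0, T] -> D t = (fine (D t))%:E.
  move=> tT; rewrite fineK// ge0_fin_numE ?L2norm_ge0//.
  by apply: le_lt_trans (DM t tT) _; rewrite ltry.
have step Th : 0 <= Th ->
    (forall t, t \in `[0, T] -> (D t <= (Th * expR (w ^+ 4 * t))%:E)%E) ->
    forall t, t \in `[0, T] -> (D t <= ((2 * C * d0 + Th / 2) * expR (w ^+ 4 * t))%:E)%E.
  move=> Th0 DTh.
  apply: (@ae_le_everywhere T D (fun t => (2 * C * d0 + Th / 2) * expR (w ^+ 4 * t))) => //.
  - by move=> t e tT e0; exact: C_L2_difference_lsc.
  - move=> t; change (continuous_at t
      (fun t : R => (2 * C * d0 + Th / 2) * expR (w ^+ 4 * t))); fcont.
  apply: ae_imp (ae_and equ eqv) => t [eut evt] tT.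
  have sub s : 0 < s < T -> s \in `[0, T] by rewrite in_itv/= => /andP[/ltW -> /ltW ->].
  have tT' : 0 < t < T by move: tT; rewrite in_itv.
  apply: le_trans (@mild_difference_L2 R T C M w Th t u0 v0 u v HC C0 M0 w0 Th0 tT' u0L v0L
    mu' mv' _ _ _ (eut tT) (evt tT)) _.
  - by move=> s /sub sT; split; [exact: C_L2_measurable cu sT|exact: uM].
  - by move=> s /sub sT; split; [exact: C_L2_measurable cv sT|exact: vM].
  - by move=> s /sub sT; exact: DTh.
  rewrite d0E -EFinM -EFinD lee_fin [leRHS]mulrDl lerD//.
    rewrite ler_peMr ?mulr_ge0 ?(ltW C0)//.
    have := expR_ge1Dx (w ^+ 4 * t); have : 0 <= w ^+ 4 * t.
      by rewrite mulr_ge0 ?exprn_ge0 ?(ltW w0)//; case/andP: tT' => /ltW.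
    by lra.
  rewrite (_ : 2 * C * M * Th * (expR (w ^+ 4 * t) * (16 / w)) =
    (32 * C * M / w) * Th * expR (w ^+ 4 * t)); last by field; rewrite gt_eqF.
  rewrite ler_wpM2r ?expR_ge0// mulrC ler_wpM2l// ler_pdivrMr// /w.
  by lra.
(* the best a priori constant [Th] is the supremum of [phi] over the interval *)
pose phi t := fine (D t) / expR (w ^+ 4 * t).
have phi0 t : 0 <= phi t by rewrite divr_ge0 ?expR_ge0// fine_ge0// L2norm_ge0.
pose S := [set phi t | t in `[0, T]%classic].
have T00 : (0 : R) \in `[0, T] by rewrite in_itv/= lexx ltW.
have S0 : S !=set0 by exists (phi 0); exists 0.
have Sub : has_sup S.
  split => //; exists (2 * M) => _ [t tT <-].
  have e1 : 1 <= expR (w ^+ 4 * t).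
    have := expR_ge1Dx (w ^+ 4 * t); have : 0 <= w ^+ 4 * t; last by lra.
    by rewrite mulr_ge0 ?exprn_ge0 ?(ltW w0)//; move: tT; rewrite /= in_itv/= => /andP[].
  rewrite /phi ler_pdivrMr ?expR_gt0//; apply: (@le_trans _ _ (2 * M)).
    by rewrite -lee_fin -DE ?DM.
  by rewrite ler_peMr// mulr_ge0.
pose Th := sup S.
have phiTh t : t \in `[0, T] -> phi t <= Th by move=> tT; apply: (sup_ubound Sub.2); exists t.
have Th0 : 0 <= Th by apply: le_trans (phi0 0) (phiTh 0 T00).
have DTh t : t \in `[0, T] -> (D t <= (Th * expR (w ^+ 4 * t))%:E)%E.
  by move=> tT; rewrite DE// lee_fin -ler_pdivrMr ?expR_gt0//; exact: phiTh.
have Th2 : Th <= 2 * C * d0 + Th / 2.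
  apply: ge_sup => // _ [t tT <-]; rewrite /phi ler_pdivrMr ?expR_gt0//.
  by rewrite -lee_fin -DE//; exact: step.
move=> t tT; apply: le_trans (DTh t tT) _.
rewrite d0E -EFinM lee_fin -/w.
have Th4 : Th <= 4 * C * d0 by lra.
apply: le_trans (_ : 4 * C * d0 * expR (w ^+ 4 * t) <= _).
  by rewrite ler_wpM2r ?expR_ge0.
rewrite mulrAC ler_wpM2r// ler_wpM2l ?mulr_ge0 ?(ltW C0)// ler_expR.
by rewrite ler_wpM2l ?exprn_ge0 ?(ltW w0)//; move: tT; rewrite in_itv/= => /andP[].
Qed.

End Bootstrapping.

Theorem proposition1 (R : realType) :
  exists C : R -> R -> R -> R -> R,
  forall (T : R) (u0 v0 : R -> R) (u v : R -> R -> R),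
    0 < T ->
    u0 \in L2 R -> v0 \in L2 R ->
    mild_solution T u0 u -> C_L2 T u ->
    mild_solution T v0 v -> C_L2 T v ->
    let M := fine (maxe (C_L2norm T u) (C_L2norm T v)) in
    (C_L2norm T (fun t x => u t x - v t x)%R
      <= (C T M (fine (L2norm u0)) (fine (L2norm v0)))%:E
         * L2norm (fun x => u0 x - v0 x)%R)%E.
Proof.
have /choice[K HK] : forall T : R, exists C : R, 0 < T -> 0 < C /\ kernel_L2_estimates T C.
  move=> T; have [T0|T0] := ltP 0 T; last by exists 0.
  by have [C C0 HC] := ex_kernel_L2_estimates T0; exists C.
exists (fun T M _ _ => 4 * K T * expR ((64 * K T * M + 1) ^+ 4 * T)).
move=> T u0 v0 u v T0 u0L v0L mu_ cu mv_ cv; cbv zeta.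
set M := fine (maxe (C_L2norm T u) (C_L2norm T v)).
have [C0 HC] := HK T T0.
have bound w w0 : mild_solution T w0 w -> C_L2 T w ->
    exists B : R, forall t, t \in `[0, T] -> (L2norm (w t) <= B%:E)%E.
  by move=> [[_ [B hB]] _] cw; exists B; exact: C_L2_bound cw hB.
have T00 : (0 : R) \in `[0, T] by rewrite in_itv/= lexx ltW.
have normE w w0 : mild_solution T w0 w -> C_L2 T w ->
    [/\ (0 <= C_L2norm T w)%E, (C_L2norm T w < +oo)%E &
      forall t, t \in `[0, T] -> (L2norm (w t) <= C_L2norm T w)%E].
  move=> mw cw; have [B hB] := bound w w0 mw cw.
  have le t : t \in `[0, T] -> (L2norm (w t) <= C_L2norm T w)%E.
    by move=> tT; apply: ereal_sup_ubound; exists t.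
  split => //; first exact: le_trans (L2norm_ge0 _) (le 0 T00).
  apply: le_lt_trans (ltry B); apply: ge_ereal_sup => _ [t tT <-]; exact: hB.
have [u_ge0 u_lty u_le] := normE u u0 mu_ cu.
have [v_ge0 v_lty v_le] := normE v v0 mv_ cv.
have ME : M%:E = maxe (C_L2norm T u) (C_L2norm T v).
  by rewrite /M fineK// ge0_fin_numE ?gt_max ?u_lty// le_max u_ge0.
have M0 : 0 <= M by rewrite -lee_fin ME le_max u_ge0.
apply: ge_ereal_sup => _ [t tT <-].
apply: stability M0 HC u0L v0L mu_ cu mv_ cv _ _ _ tT => // s sT.
- by rewrite ME le_max u_le.
- by rewrite ME le_max v_le ?orbT.
Qed.
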